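(* Let $A=(KQ/\mathcal{I},\leqslant)$ be a 1-quasi-hereditary algebra, $j\in Q_0$, $r=|\Lambda^{(j)}|$ and $$\mathcal{L}(j):=\{\mathbf{i}=(i_1,i_2,\ldots,i_r)\mid i_m\in\Lambda^{(j)},\ i_k\not\geqslant i_t\text{ for }1\leq k<t\leq r\}.$$ Then the following functions are (well defined and) bijective: (1) $\mathscr{D}:\mathcal{L}(j)\to\{\Delta\text{-good filtrations of }P(j)\}$, where $\mathscr{D}(\mathbf{i})$ is the filtration $0=D(r+1)\subset D(r)\subset\cdots\subset D(t)\subset\cdots\subset D(1)$ with $D(t):=\sum_{m=t}^{r}P(i_m)$. Moreover, $D(t)/D(t+1)\cong\Delta(i_t)$ for every $1\leq t\leq r$. (2) $\mathscr{N}:\mathcal{L}(j)\to\{\nabla\text{-good filtrations of }I(j)\}$, where $\mathscr{N}(\mathbf{i})$ is the filtration $N(1)\subset\cdots\subset N(t)\subset\cdots\subset N(r)\subset N(r+1)=I(j)$ with $N(t):=\left(\bigcap_{m=t}^{r}\mathcal{K}(i_m)\right)/\mathcal{K}(j)$. Moreover, $N(t+1)/N(t)\cong\nabla(i_t)$ for every $1\leq t\leq r$.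
   Context: $K$ is an algebraically closed field, $Q$ is a finite quiver with vertex set $Q_0$, and $KQ/\mathcal{I}$ is a finite-dimensional bound quiver algebra ($\mathcal{I}$ an admissible ideal). Modules are finite-dimensional left modules. For $i\in Q_0$, $S(i)$, $P(i)$, $I(i)$ denote the simple, projective indecomposable and injective indecomposable module at $i$; $[M:S(i)]$ is the Jordan-Hölder multiplicity. Let $\leqslant$ be a partial order on $Q_0$. The standard module $\Delta(i)$ is the largest factor module of $P(i)$ with $[\Delta(i):S(j)]=0$ for all $j\not\leqslant i$; the costandard module $\nabla(i)$ is the largest submodule of $I(i)$ with $[\nabla(i):S(j)]=0$ for all $j\not\leqslant i$. A $\Delta$-good (resp. $\nabla$-good) filtration of a module is a chain of submodules from $0$ to the module all of whose subquotients are isomorphic to standard (resp. costandard) modules; a module with a $\Delta$-good filtration is $\Delta$-good and $(M:\Delta(i))$ is the (well-defined) number of subquotients isomorphic to $\Delta(i)$. $(KQ/\mathcal{I},\leqslant)$ is quasi-hereditary if for all $i,j\in Q_0$: $[\Delta(i):S(i)]=1$, and $P(i)$ is $\Delta$-good with $(P(i):\Delta(j))=0$ for $j\not\geqslant i$ and $(P(i):\Delta(i))=1$. A quasi-hereditary algebra $A=(KQ/\mathcal{I},\leqslant)$ is 1-quasi-hereditary if for all $i,j\in Q_0=\{1,\ldots,n\}$: (1) there is a smallest and a largest element with respect to $\leqslant$, denoted $1$ and $n$ respectively; (2) $[\Delta(i):S(j)]=(P(j):\Delta(i))=1$ for $j\leqslant i$; (3) $\operatorname{soc}P(j)\cong\operatorname{top}I(j)\cong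 S(1)$; (4) there are an injection $\Delta(i)\hookrightarrow\Delta(n)$ and a surjection $\nabla(n)\twoheadrightarrow\nabla(i)$. $\Lambda^{(j)}=\{i\in Q_0\mid i\geqslant j\}$. For $i\in\Lambda^{(j)}$ there is a unique submodule of $P(j)$ isomorphic to $P(i)$, and $P(i)$ is regarded as this submodule. One has $P(1)\cong I(1)$, and $\mathcal{K}(j)$ denotes the kernel of the surjection $P(1)\cong I(1)\twoheadrightarrow I(j)$ (it does not depend on the surjection), so $I(j)=P(1)/\mathcal{K}(j)$, and $\mathcal{K}(j)\subseteq\mathcal{K}(i)$ iff $i\in\Lambda^{(j)}$. The empty intersection is $P(1)$. *)

(* Defs.v *)
From HB Require Import structures.
From mathcomp Require Import all_boot all_order all_algebra all_field.
From mathcomp Require Import finmap monalg.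
From mathcomp Require Import boolp classical_sets functions.

Set Implicit Arguments.
Unset Strict Implicit.
Unset Printing Implicit Defensive.

Import Order.TTheory GRing.Theory.
Local Open Scope ring_scope.

Record quiver (V : finType) := Quiver {
  arrow : finType;
  src : arrow -> V;
  tgt : arrow -> V
}.

Section PathAlgebra.
Variables (V : finType) (Q : quiver V).

Fixpoint walk (i : V) (s : seq (arrow Q)) : bool :=
  if s is a :: s' then (src a == i) && walk (tgt a) s' else true.

Definition walk_end (i : V) (s : seq (arrow Q)) : V := last i (map (@tgt V Q) s).

(* A path is its starting vertex together with the arrows in the order in which
   they are traversed; (i, [::]) is the trivial path at i. *)
Definition qpath := {p : V * seq (arrow Q) | walk p.1 p.2}.

Definition pstart (p : qpath) : V := (val p).1.
Definition pend (p : qpath) : V := walk_end (val p).1 (val p).2.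

Definition trivial_path (i : V) : qpath := exist _ (i, [::]) isT.

Lemma walk1 (a : arrow Q) : walk (src a) [:: a].
Proof. by rewrite /= eqxx. Qed.
Definition arrow_path (a : arrow Q) : qpath := exist _ (src a, [:: a]) (walk1 a).

Lemma walk_cat i s1 s2 : walk i (s1 ++ s2) = walk i s1 && walk (walk_end i s1) s2.
Proof. by elim: s1 i => //= a s1 IH i; rewrite IH andbA. Qed.

Lemma walk_end_cat i s1 s2 : walk_end i (s1 ++ s2) = walk_end (walk_end i s1) s2.
Proof. by rewrite /walk_end map_cat last_cat. Qed.

Definition raw_comp (p q : qpath) : V * seq (arrow Q) :=
  ((val q).1, (val q).2 ++ (val p).2).

Lemma walk_comp (p q : qpath) : pstart p == pend q ->
  walk (raw_comp p q).1 (raw_comp p q).2.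
Proof.
by move=> /eqP e; rewrite /= walk_cat (valP q) /= -[walk_end _ _]/(pend q) -e (valP p).
Qed.

(* Arrows compose like functions: [pcomp p q] is "first q, then p". *)
Definition pcomp (p q : qpath) : option qpath :=
  if pstart p == pend q then (insub (raw_comp p q) : option qpath) else None.

Lemma pcompT p q (e : pstart p == pend q) :
  pcomp p q = Some (exist _ (raw_comp p q) (walk_comp e)).
Proof.
rewrite /pcomp e; case: insubP => [r _ er|/negP[]]; last exact: walk_comp.
by congr Some; apply: val_inj.
Qed.

Lemma pcomp_end p q r : pcomp p q = Some r ->
  [/\ pstart p == pend q, val r = raw_comp p q, pstart r = pstart q & pend r = pend p].
Proof.
case e: (pstart p == pend q); last by rewrite /pcomp e.
rewrite (pcompT e) => -[<-]; split=> //.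
by rewrite /pend /= walk_end_cat -[walk_end _ (val q).2]/(pend q) -(eqP e).
Qed.

Lemma pcomp_none p q : pcomp p q = None -> (pstart p == pend q) = false.
Proof. by case e: (pstart p == pend q) => //; rewrite (pcompT e). Qed.

Lemma pcompA p q r :
  obind (fun s => pcomp p s) (pcomp q r) = obind (fun s => pcomp s r) (pcomp p q).
Proof.
case E1: (pcomp q r) => [s|] /=; case E2: (pcomp p q) => [t|] //=.
- have [e1 v1 s1 n1] := pcomp_end E1; have [e2 v2 s2 n2] := pcomp_end E2.
  rewrite /pcomp n1 s2 e1 e2; congr insub.
  by rewrite /raw_comp v1 v2 /= catA.
- by have [_ _ _ n1] := pcomp_end E1; rewrite /pcomp n1 (pcomp_none E2).
- by have [_ _ s2 _] := pcomp_end E2; rewrite /pcomp s2 (pcomp_none E1).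
Qed.

Lemma pcomp1p i p : pcomp (trivial_path i) p = if i == pend p then Some p else None.
Proof.
rewrite /pcomp -[pstart (trivial_path i)]/i; case: ifP => // e.
have -> : raw_comp (trivial_path i) p = val p by rewrite /raw_comp cats0; case: (val p).
by rewrite valK.
Qed.

Lemma pcompp1 i p : pcomp p (trivial_path i) = if pstart p == i then Some p else None.
Proof.
rewrite /pcomp -[pend (trivial_path i)]/i; case: ifP => // /eqP e.
have -> : raw_comp p (trivial_path i) = val p by rewrite -e; case: p {e} => [[]].
by rewrite valK.
Qed.

Variable K : fieldType.

Definition path_algebra := {malg K[qpath]}.
HB.instance Definition _ := GRing.Lmodule.on path_algebra.

Definition pbasis (o : option qpath) : path_algebra :=
  if o is Some p then << p >> else 0.

Definition pext (f : qpath -> path_algebra) (x : path_algebra) : path_algebra :=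
  \sum_(p <- msupp x) x@_p *: f p.

Definition pmul (x y : path_algebra) : path_algebra :=
  pext (fun p => pext (fun q => pbasis (pcomp p q)) y) x.

Definition pone : path_algebra := \sum_(i : V) << trivial_path i >>.

Lemma pext_wide f (x : path_algebra) (D : {fset qpath}) : (msupp x `<=` D)%fset ->
  pext f x = \sum_(p <- D) x@_p *: f p.
Proof.
move=> sD; rewrite /pext (big_fset_incl _ sD) // => p _ Np.
by rewrite mcoeff_outdom // scale0r.
Qed.

Lemma pext_linear f : linear (pext f).
Proof.
move=> c x y; pose D := (msupp x `|` msupp y)%fset.
have sx : (msupp x `<=` D)%fset by apply: fsubsetUl.
have sy : (msupp y `<=` D)%fset by apply: fsubsetUr.
have sc : (msupp (c *: x + y : path_algebra) `<=` D)%fset.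
  apply: fsubset_trans (msuppD_le _ _) _; rewrite fsubUset sy andbT.
  by apply: fsubset_trans sx; apply: msuppZ_le.
rewrite !(@pext_wide f _ D) // scaler_sumr -big_split /=.
by apply: eq_bigr => p _; rewrite mcoeffD mcoeffZ scalerDl scalerA.
Qed.
HB.instance Definition _ f :=
  GRing.isLinear.Build K path_algebra path_algebra _ (pext f) (pext_linear f).

Lemma pextU f p : pext f << p >> = f p.
Proof. by rewrite /pext msuppU oner_eq0 big_seq_fset1 mcoeffUU scale1r. Qed.

Lemma pext_basis f o : pext f (pbasis o) = if o is Some p then f p else 0.
Proof. by case: o => [p|] /=; rewrite ?pextU ?linear0. Qed.

Lemma eq_pext f g x : f =1 g -> pext f x = pext g x.
Proof. by move=> e; apply: eq_bigr => p _; rewrite e. Qed.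

Lemma pextE x : x = pext (fun p => << p >>) x.
Proof.
rewrite {1}[x]monalgE /pext; apply: eq_bigr => p _.
by apply/malgP => k; rewrite [RHS]mcoeffZ [LHS]mcoeffU [X in _ * X]mcoeffU mulr_natr.
Qed.

Lemma pext_pext f g x : pext f (pext g x) = pext (fun p => pext f (g p)) x.
Proof.
by rewrite {2}/pext linear_sum /=; apply: eq_bigr => p _; rewrite linearZ.
Qed.

Lemma pmulA : associative pmul.
Proof.
move=> x y z; rewrite /pmul [RHS]pext_pext; apply: eq_pext => p.
rewrite [LHS]pext_pext [RHS]pext_pext; apply: eq_pext => q.
rewrite [RHS]pext_basis [LHS]pext_pext.
transitivity (pext (fun r => pbasis (obind (fun s => pcomp s r) (pcomp p q))) z).
  apply: eq_pext => r; rewrite [LHS]pext_basis -pcompA.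
  by case: (pcomp q r).
case: (pcomp p q) => [s|] //=.
by rewrite /pext big1 // => r _; rewrite scaler0.
Qed.

Lemma pmulDl : left_distributive pmul +%R.
Proof. by move=> x y z; rewrite /pmul linearD. Qed.

Lemma pmulDr : right_distributive pmul +%R.
Proof.
move=> x y z; rewrite /pmul -[in RHS]big_split /=; apply: eq_bigr => p _.
by rewrite linearD scalerDr.
Qed.

Lemma pmul1x : left_id pone pmul.
Proof.
move=> x; rewrite /pmul /pone linear_sum /=.
under eq_bigr do rewrite pextU.
transitivity (pext (fun p => << p >>) x); last by rewrite -pextE.
rewrite /pext exchange_big /=; apply: eq_bigr => p _.
rewrite -scaler_sumr; congr (_ *: _).
rewrite (bigD1 (pend p)) //= pcomp1p eqxx /= big1 ?addr0 // => i /negPf ne.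
by rewrite pcomp1p ne.
Qed.

Lemma pmulx1 : right_id pone pmul.
Proof.
move=> x; rewrite /pmul /pone.
transitivity (pext (fun p => << p >>) x); last by rewrite -pextE.
apply: eq_pext => p; rewrite linear_sum /=.
under eq_bigr do rewrite pextU.
rewrite (bigD1 (pstart p)) //= pcompp1 eqxx /= big1 ?addr0 // => i ne.
by rewrite pcompp1 eq_sym (negPf ne).
Qed.

HB.instance Definition _ := GRing.Zmodule_isPzRing.Build path_algebra
  pmulA pmul1x pmulx1 pmulDl pmulDr.

Definition path_of (p : qpath) : path_algebra := << p >>.

End PathAlgebra.

Local Open Scope classical_set_scope.

Section Admissible.
Variables (K : fieldType) (V : finType) (Q : quiver V).
Local Notation KQ := (path_algebra Q K).

Definition two_sided_ideal (J : set KQ) : Prop :=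
  [/\ J 0, (forall x y, J x -> J y -> J (x + y)),
      (forall a x, J x -> J (a * x)) & (forall a x, J x -> J (x * a))].

Definition ideal_gen (X : set KQ) : set KQ :=
  [set x | forall J, two_sided_ideal J -> X `<=` J -> J x].

Definition ideal_mul (J1 J2 : set KQ) : set KQ :=
  ideal_gen [set z | exists x y, [/\ J1 x, J2 y & z = x * y]].

Definition ideal_pow (J : set KQ) (m : nat) : set KQ := iter m (ideal_mul J) setT.

Definition arrow_ideal : set KQ :=
  ideal_gen (range (fun a : arrow Q => path_of K (arrow_path a))).

Definition admissible (J : set KQ) : Prop :=
  two_sided_ideal J /\
  exists2 m, (2 <= m)%N &
    ideal_pow arrow_ideal m `<=` J /\ J `<=` ideal_pow arrow_ideal 2.

(* [phi] exhibits A as KQ/I, where I is the kernel of phi.  As I contains a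
   power of the arrow ideal, KQ/I is finite-dimensional, whence the choice of
   falgType for A. *)
Definition bound_quiver_algebra (A : falgType K) (phi : {rmorphism KQ -> A}) :=
  [/\ scalable phi, (forall a, exists x, phi x = a) &
      admissible [set x | phi x = 0]].

End Admissible.

Section Modules.
Variables (K : fieldType) (A : falgType K).

Record module := Module {
  carrier :> vectType K;
  act : A -> carrier -> carrier;
  actDl : forall (c : K) (a b : A) v, act (c *: a + b) v = c *: act a v + act b v;
  actDr : forall (c : K) (a : A) v w, act a (c *: v + w) = c *: act a v + act a w;
  act1 : forall v, act 1 v = v;
  actM : forall a b v, act (a * b) v = act a (act b v)
}.

Lemma actD (M : module) a (v w : M) : act a (v + w) = act a v + act a w.
Proof. by have := actDr 1 a v w; rewrite !scale1r. Qed.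
Lemma act0 (M : module) a : act a (0 : M) = 0.
Proof. by apply: (addrI (act a 0)); rewrite -actD !addr0. Qed.

Record modhom (M N : module) := Hom {
  homf :> 'Hom(M, N);
  hom_act : forall a v, homf (act a v) = act a (homf v)
}.

Definition embedding (M N : module) (f : modhom M N) : Prop := lker f = 0%VS.
Definition surjection (M N : module) (f : modhom M N) : Prop := limg f = fullv.
Definition iso (M N : module) : Prop :=
  exists f : modhom M N, embedding f /\ surjection f.

Definition stable (M : module) (U : {vspace M}) : Prop :=
  forall a v, v \in U -> act a v \in U.

Definition submodule (M : module) := {U : {vspace M} | `[< stable U >]}.
Definition sub_space (M : module) (U : submodule M) : {vspace M} := val U.
Coercion sub_space : submodule >-> space.

Definition Sub_module (M : module) (U : {vspace M}) (sU : stable U) : submodule M :=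
  exist _ U (asboolT sU).

Lemma stableP (M : module) (U : submodule M) : stable U.
Proof. exact: asboolW (valP U). Qed.

Lemma stable0 (M : module) : stable (0%VS : {vspace M}).
Proof. by move=> a v; rewrite !memv0 => /eqP->; rewrite act0. Qed.
Definition sub0 (M : module) : submodule M := Sub_module (@stable0 M).

Lemma stableT (M : module) : stable (fullv : {vspace M}).
Proof. by move=> a v _; rewrite memvf. Qed.
Definition subT (M : module) : submodule M := Sub_module (@stableT M).

Lemma stableD (M : module) (U W : submodule M) : stable (U + W)%VS.
Proof.
move=> a _ /memv_addP[u Uu [w Ww ->]].
by rewrite actD memv_add //; apply: stableP.
Qed.
Definition subD (M : module) (U W : submodule M) : submodule M :=
  Sub_module (@stableD M U W).

Lemma stableI (M : module) (U W : submodule M) : stable (U :&: W)%VS.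
Proof.
by move=> a v; rewrite !memv_cap => /andP[Uv Wv]; rewrite !stableP.
Qed.
Definition subI (M : module) (U W : submodule M) : submodule M :=
  Sub_module (@stableI M U W).

Lemma stable_ker (M N : module) (f : modhom M N) : stable (lker f).
Proof. by move=> a v; rewrite !memv_ker hom_act => /eqP->; rewrite act0. Qed.
Definition hker (M N : module) (f : modhom M N) : submodule M :=
  Sub_module (@stable_ker M N f).

Lemma stable_img (M N : module) (f : modhom M N) (U : submodule M) : stable (f @: U)%VS.
Proof.
move=> a _ /memv_imgP[u Uu ->]; rewrite -hom_act.
by apply: memv_img; apply: stableP.
Qed.
Definition himg (M N : module) (f : modhom M N) (U : submodule M) : submodule N :=
  Sub_module (@stable_img M N f U).

Section SubQuotient.
Variables (M : module) (U : submodule M).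

Definition submod_act (a : A) (v : subvs_of U) : subvs_of U :=
  vsproj U (act a (vsval v)).

Lemma submod_actE a v : vsval (submod_act a v) = act a (vsval v).
Proof. by rewrite vsprojK //; apply: stableP; apply: subvsP. Qed.

Lemma submod_actDl c a b v :
  submod_act (c *: a + b) v = c *: submod_act a v + submod_act b v.
Proof. by apply: subvs_inj; rewrite linearP /= !submod_actE actDl. Qed.
Lemma submod_actDr c a v w :
  submod_act a (c *: v + w) = c *: submod_act a v + submod_act a w.
Proof. by apply: subvs_inj; rewrite linearP /= !submod_actE linearP actDr. Qed.
Lemma submod_act1 v : submod_act 1 v = v.
Proof. by apply: subvs_inj; rewrite submod_actE act1. Qed.
Lemma submod_actM a b v : submod_act (a * b) v = submod_act a (submod_act b v).
Proof. by apply: subvs_inj; rewrite !submod_actE actM. Qed.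

Definition submod : module :=
  Module submod_actDl submod_actDr submod_act1 submod_actM.

(* M/U is realized on the complement U^C: [quot_map] projects onto U^C along U,
   so it is onto with kernel U, and [quot_rep] picks representatives. *)
Definition quot_map (v : M) : subvs_of (U^C)%VS :=
  vsproj (U^C)%VS (daddv_pi (U^C)%VS U v).
Definition quot_rep (w : subvs_of (U^C)%VS) : M := vsval w.
Definition quot_act (a : A) (w : subvs_of (U^C)%VS) : subvs_of (U^C)%VS :=
  quot_map (act a (quot_rep w)).

Lemma quot_map_linear : linear quot_map.
Proof. by move=> c v w; rewrite /quot_map !linearP. Qed.

Lemma compl_capv : ((U^C)%VS :&: U = 0)%VS.
Proof. by rewrite capvC capv_compl. Qed.
Lemma compl_addv : ((U^C)%VS + U = fullv)%VS.
Proof. by rewrite addvC addv_complf. Qed.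

Lemma quot_decomp v : v - quot_rep (quot_map v) \in (U : {vspace M}).
Proof.
rewrite /quot_rep vsprojK ?memv_pi //.
have /(daddv_pi_add compl_capv) {1}<- : v \in ((U^C)%VS + U)%VS.
  by rewrite compl_addv memvf.
by rewrite addrC addKr memv_pi.
Qed.

Lemma quot_map_eq0 v : v \in (U : {vspace M}) -> quot_map v = 0.
Proof.
move=> Uv; apply: subvs_inj; rewrite linear0 vsprojK ?memv_pi //.
have := daddv_pi_add compl_capv (_ : v \in ((U^C)%VS + U)%VS).
rewrite compl_addv memvf => /(_ isT).
rewrite (daddv_pi_id (capv_compl U) Uv) => /(congr1 (fun x => x - v)).
by rewrite addrK subrr.
Qed.

Lemma quot_repK w : quot_map (quot_rep w) = w.
Proof.
apply: subvs_inj; rewrite vsprojK ?memv_pi //.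
by rewrite daddv_pi_id ?compl_capv //; apply: subvsP.
Qed.

Lemma quot_map_act a v : quot_map (act a v) = quot_act a (quot_map v).
Proof.
apply/eqP; rewrite -subr_eq0 /quot_act.
have quotB x y : quot_map x - quot_map y = quot_map (x - y).
  by rewrite addrC -scaleN1r -quot_map_linear scaleN1r addrC.
rewrite quotB quot_map_eq0 //.
suff -> : act a v - act a (quot_rep (quot_map v)) = act a (v - quot_rep (quot_map v)).
  by apply: stableP; apply: quot_decomp.
by apply/eqP; rewrite subr_eq -actD subrK.
Qed.

Lemma quot_actDl c a b v :
  quot_act (c *: a + b) v = c *: quot_act a v + quot_act b v.
Proof. by rewrite /quot_act actDl quot_map_linear. Qed.
Lemma quot_actDr c a v w :
  quot_act a (c *: v + w) = c *: quot_act a v + quot_act a w.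
Proof. by rewrite /quot_act /quot_rep linearP actDr quot_map_linear. Qed.
Lemma quot_act1 v : quot_act 1 v = v.
Proof. by rewrite /quot_act act1 quot_repK. Qed.
Lemma quot_actM a b v : quot_act (a * b) v = quot_act a (quot_act b v).
Proof. by rewrite -[v in RHS]quot_repK -!quot_map_act -actM. Qed.

Definition quotmod : module := Module quot_actDl quot_actDr quot_act1 quot_actM.

End SubQuotient.

Lemma stable_preim (M : module) (U W : submodule M) :
  stable (linfun (vsval : submod U -> M) @^-1: W)%VS.
Proof.
move=> a v; rewrite -!memv_preim !lfunE /= => Wv.
by rewrite submod_actE; apply: stableP.
Qed.

(* For W <= U, this is W viewed as a submodule of the module U. *)
Definition sub_in (M : module) (U W : submodule M) : submodule (submod U) :=
  Sub_module (@stable_preim M U W).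

(* U/W, for W <= U *)
Definition subquot (M : module) (U W : submodule M) : module := quotmod (sub_in U W).

Definition least (M : module) (P : submodule M -> Prop) : set (submodule M) :=
  [set U | P U /\ forall W : submodule M, P W -> (U <= W)%VS].
Definition greatest (M : module) (P : submodule M -> Prop) : set (submodule M) :=
  [set U | P U /\ forall W : submodule M, P W -> (W <= U)%VS].

Definition simple (M : module) : Prop :=
  (fullv : {vspace M}) <> 0%VS /\
  forall U : submodule M, sub_space U = 0%VS \/ sub_space U = fullv.

Definition maximal (M : module) (U : submodule M) : Prop :=
  sub_space U <> fullv /\
  forall W : submodule M, (U <= W)%VS -> sub_space W = U \/ sub_space W = fullv.

(* [soc] is the sum of the simple submodules, [rad] the intersection of the
   maximal ones. *)
Definition soc (M : module) : submodule M :=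
  xget (sub0 M)
    (least (fun U => forall W : submodule M, simple (submod W) -> (W <= U)%VS)).
Definition rad (M : module) : submodule M :=
  xget (sub0 M)
    (greatest (fun U => forall W : submodule M, maximal W -> (U <= W)%VS)).
Definition module_top (M : module) : module := quotmod (rad M).

(* F = [:: F_0; ...; F_l] with 0 = F_0 <= ... <= F_l = M, all of whose
   subquotients satisfy C *)
Definition filtration (C : module -> Prop) (M : module) (F : seq (submodule M)) : Prop :=
  [/\ (0 < size F)%N,
      nth (sub0 M) F 0 = sub0 M,
      nth (sub0 M) F (size F).-1 = subT M &
      forall k, (k.+1 < size F)%N ->
        let U := nth (sub0 M) F k.+1 in let W := nth (sub0 M) F k in
        (W <= U)%VS /\ C (subquot U W)].

Definition factor_count (M : module) (F : seq (submodule M)) (X : module) : nat :=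
  \sum_(k < (size F).-1)
    `[< iso (subquot (nth (sub0 M) F k.+1) (nth (sub0 M) F k)) X >].

(* The number of subquotients isomorphic to X in a filtration of M with
   subquotients in C; only used where this does not depend on the filtration. *)
Definition multiplicity (C : module -> Prop) (M X : module) : nat :=
  xget 0%N [set m | exists2 F, filtration C F & m = @factor_count M F X].

Definition JH_mult (M X : module) : nat := multiplicity simple M X.

Definition regular : module.
Proof.
refine (@Module A (fun a v => a * v) _ _ _ _).
- by move=> c a b v; rewrite mulrDl scalerAl.
- by move=> c a v w; rewrite mulrDr scalerAr.
- exact: mul1r.
- by move=> a b v; rewrite mulrA.
Defined.

Lemma stable_left_ideal (U : {vspace A}) :
  @stable regular ({:A} * U)%VS.
Proof.
move=> a v Uv; have : a * v \in ({:A} * ({:A} * U))%VS by rewrite memv_mul ?memvf.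
rewrite prodvA; apply: subvP.
by apply: prodvSl; apply: subvf.
Qed.
Definition left_ideal (U : {vspace A}) : submodule regular :=
  Sub_module (@stable_left_ideal U).

Section Dual.
Variable e : A.
Definition right_ideal : {vspace A} := (<[e]> * {:A})%VS.

Definition rmul (a : A) : 'End(subvs_of right_ideal) :=
  linfun (fun x : subvs_of right_ideal => vsproj right_ideal (vsval x * a)).

Lemma rmul_linear a :
  linear (fun x : subvs_of right_ideal => vsproj right_ideal (vsval x * a)).
Proof. by move=> c x y; rewrite linearP mulrDl -scalerAl linearP. Qed.

Lemma rmulE a x : vsval (rmul a x) = vsval x * a.
Proof.
pose f := GRing.isLinear.Build K (subvs_of right_ideal) (subvs_of right_ideal) _ _
  (rmul_linear a).
pose g : {linear _ -> _} := HB.pack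
  (fun x : subvs_of right_ideal => vsproj right_ideal (vsval x * a)) f.
have -> : rmul a x = g x by rewrite -[RHS](lfunE g).
rewrite vsprojK //; have : vsval x * a \in (right_ideal * {:A})%VS.
  by rewrite memv_mul ?memvf ?subvsP.
rewrite -prodvA; apply: subvP.
by apply: prodvSr; apply: subvf.
Qed.

Definition dual_act (a : A) (f : 'Hom(subvs_of right_ideal, K^o)) :
  'Hom(subvs_of right_ideal, K^o) := (f \o rmul a)%VF.

(* D(eA) = Hom_K(eA, K) with (a f)(x) = f(x a) *)
Definition dual_right_ideal : module.
Proof.
refine (@Module 'Hom(subvs_of right_ideal, K^o) dual_act _ _ _ _).
- move=> c a b f; apply/lfunP => x.
  have eab : rmul (c *: a + b) x = c *: rmul a x + rmul b x.
    by apply: subvs_inj; rewrite linearP /= !rmulE mulrDr scalerAr.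
  by rewrite /dual_act comp_lfunE eab linearP !lfunE /= !lfunE /= !lfunE.
- by move=> c a f g; apply/lfunP => x; rewrite !lfunE /= !lfunE /= !lfunE.
- move=> f; apply/lfunP => x; rewrite lfunE /=; congr (f _).
  by apply: subvs_inj; rewrite rmulE mulr1.
- move=> a b f; apply/lfunP => x; rewrite !lfunE /= !lfunE /=; congr (f _).
  by apply: subvs_inj; rewrite !rmulE mulrA.
Defined.

End Dual.

End Modules.

Section QuasiHereditary.
Variables (K : fieldType) (d : Order.disp_t) (V : finPOrderType d) (Q : quiver V).
Variables (A : falgType K) (phi : {rmorphism path_algebra Q K -> A}).

Definition idem (i : V) : A := phi (path_of K (trivial_path Q i)).

(* A e_i as a submodule of A, and as a module *)
Definition Aidem (i : V) : submodule (regular A) := left_ideal <[idem i]>%VS.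
Definition Pmod (i : V) : module A := submod (Aidem i).

Definition Imod (i : V) : module A := dual_right_ideal (idem i).

Definition arrow_space : {vspace A} :=
  <<[seq phi (path_of K (arrow_path a)) | a <- enum (arrow Q)]>>%VS.

(* S(i) = A e_i / J e_i, with J = A (arrows) A the image of the arrow ideal *)
Definition Smod (i : V) : module A :=
  subquot (Aidem i) (left_ideal (arrow_space * {:A} * <[idem i]>)%VS).

Definition bounded_factors (i : V) (M : module A) : Prop :=
  forall j, ~~ (j <= i)%O -> JH_mult M (Smod j) = 0%N.

Definition Delta (i : V) : module A :=
  quotmod (xget (sub0 (Pmod i))
    (least (fun U : submodule (Pmod i) => bounded_factors i (quotmod U)))).

Definition Nabla (i : V) : module A :=
  submod (xget (sub0 (Imod i))
    (greatest (fun U : submodule (Imod i) => bounded_factors i (submod U)))).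

Definition good_filtrations (X : V -> module A) (M : module A) :
  set (seq (submodule M)) :=
  [set F | filtration (fun N => exists i, iso N (X i)) F].

Definition Delta_good (M : module A) : Prop := exists F, @good_filtrations Delta M F.

(* (M : Delta(i)) *)
Definition Delta_mult (M : module A) (i : V) : nat :=
  multiplicity (fun N => exists k, iso N (Delta k)) M (Delta i).

Definition quasi_hereditary : Prop := forall i : V,
  [/\ JH_mult (Delta i) (Smod i) = 1%N, Delta_good (Pmod i),
      forall j, ~~ (i <= j)%O -> Delta_mult (Pmod i) j = 0%N &
      Delta_mult (Pmod i) i = 1%N].

(* [one] and [top] are the vertices denoted 1 and n in Q_0 = {1, ..., n}. *)
Definition one_quasi_hereditary (one top : V) : Prop :=
  [/\ quasi_hereditary,
      forall i, (one <= i <= top)%O,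
      forall i j, (j <= i)%O ->
        JH_mult (Delta i) (Smod j) = 1%N /\ Delta_mult (Pmod j) i = 1%N,
      forall j, iso (submod (soc (Pmod j))) (Smod one) /\ iso (module_top (Imod j)) (Smod one) &
      forall i, (exists f : modhom (Delta i) (Delta top), embedding f) /\
                (exists f : modhom (Nabla top) (Nabla i), surjection f)].

Definition Lambda (j : V) : {set V} := [set i | (j <= i)%O]%SET.

(* Tuples are indexed from 0: [tnth s m] is i_{m+1}. *)
Definition calL (j : V) : set (#|Lambda j|.-tuple V) :=
  [set s | (forall m, tnth s m \in Lambda j) /\
           (forall k t : 'I_#|Lambda j|, (k < t)%N -> ~~ (tnth s t <= tnth s k)%O)].

(* P(i) regarded as the submodule of P(j) isomorphic to it, for i >= j *)
Definition Psub (j i : V) : submodule (Pmod j) :=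
  xget (sub0 (Pmod j)) [set U : submodule (Pmod j) | iso (submod U) (Pmod i)].

(* the kernel of the surjection P(1) -> I(j) *)
Definition calK (one j : V) : submodule (Pmod one) :=
  xget (sub0 (Pmod one))
    [set U : submodule (Pmod one) | exists2 f : modhom (Pmod one) (Imod j),
      surjection f & U = hker f].

(* With t running over 0, ..., r, these are D(t+1) and N(t+1). In [Nsub], the
   identification I(j) = P(1)/K(j) is the one given by the surjection p. *)
Definition Dsub (j : V) (s : #|Lambda j|.-tuple V) (t : nat) : submodule (Pmod j) :=
  \big[@subD _ A (Pmod j)/sub0 _]_(m < #|Lambda j| | (t <= m)%N) Psub j (tnth s m).

Definition Nsub (one j : V) (p : modhom (Pmod one) (Imod j))
    (s : #|Lambda j|.-tuple V) (t : nat) : submodule (Imod j) :=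
  himg p (\big[@subI _ A (Pmod one)/subT _]_(m < #|Lambda j| | (t <= m)%N)
            calK one (tnth s m)).

Definition scrD (j : V) (s : #|Lambda j|.-tuple V) : seq (submodule (Pmod j)) :=
  [seq Dsub s (#|Lambda j| - k) | k <- iota 0 #|Lambda j|.+1].

Definition scrN (one j : V) (p : modhom (Pmod one) (Imod j))
    (s : #|Lambda j|.-tuple V) : seq (submodule (Imod j)) :=
  [seq Nsub p s k | k <- iota 0 #|Lambda j|.+1].

End QuasiHereditary.

Arguments good_filtrations {K d V A} X M _.
Arguments calL {d V} j _.
Arguments Dsub {K d V Q A} phi j s t.
Arguments Nsub {K d V Q A phi one j} p s t.
Arguments scrD {K d V Q A} phi j s.
Arguments scrN {K d V Q A phi one j} p s.

(* Main.v *)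
From HB Require Import structures.
Require Import Defs.
From mathcomp Require Import all_boot all_order all_algebra all_field.
From mathcomp Require Import finmap monalg zify.
From mathcomp Require Import boolp classical_sets functions.

(** Write e_i for the vertex idempotents, [M:S(k)] = dim e_k M, and for a set G of
    vertices let tr_G M be the submodule generated by the e_i M (i in G), and
    rej_G M the largest submodule killed by all e_i (i in G).

    Quasi-heredity and axiom (2) give dim e_k P(j) = |{l >= j, k}|.  Since P(j) has
    simple socle S(1), it embeds into I(1), and P(1) = I(1) by comparing dimensions.
    The same comparison forces every copy of P(i) in P(j), i >= j, to be tr_i P(j).
    A Delta-filtration bounds tr_G P(j) from below, and peeling minimal elements off
    an upset G bounds it from above, so dim e_k tr_G P(j) = |{l in G, l >= j, k}|.
    By duality between e_k I(j) and e_j P(k), dim e_k rej_G I(j) is the number of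
    l >= j, k outside G.  Moreover the kernel of P(1) ->> I(i) is rej_i P(1).

    Hence removing a minimal element i from an upset G changes tr_G P(j) by Delta(i)
    and rej_G I(j) by nabla(i).  Conversely, a quotient of tr_G P(j) isomorphic to
    Delta(l) has an S(l) on top, which forces l to be minimal in G and the kernel to be
    tr_{G - l} P(j); dually for nabla(l) and the socle.  So good filtrations are the
    same as enumerations of {i >= j} that remove a minimal element at each step. *)

Set Implicit Arguments.
Unset Strict Implicit.
Unset Printing Implicit Defensive.

Import Order.TTheory GRing.Theory.
Local Open Scope ring_scope.
Local Open Scope classical_set_scope.

(** The equality [M:S(k)] = dim e_k M rests on both halves of admissibility. As ker [phi] lies in
    the square of the arrow ideal, the coefficient of a trivial path descends to a character of A;
    as ker [phi] contains a power of the arrow ideal, every nonzero module has a common eigenvector.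
    Since M -> e_k M is exact, nearly every later equality of submodules is one inclusion plus a
    count at each vertex.

    Upsets are the right index sets because tr_i P(j) lies in tr_{i'} P(j) when j <= i' <= i: all
    that lies strictly above a minimal i in tr_i P(j) is already present before i is added, so only
    Delta(i) is new.

    Quasi-heredity is stated through P and Delta alone, so the nabla side cannot be had by formally
    reversing arrows. The only duality used is e_k I(j) = Hom(e_j A e_k, K), which transports the
    dimension counts; the structural arguments are then repeated with socles in place of tops. Both
    halves end in one order-theoretic statement about chains indexed by shrinking upsets. *)

Section LinearMaps.
Variables (K : fieldType) (A : falgType K).

HB.instance Definition _ (M : module A) (a : A) :=
  GRing.isLinear.Build K M M _ (@act K A M a) (fun c v w => @actDr K A M c a v w).

Lemma eq_fullv (E : vectType K) (U : {vspace E}) : (fullv <= U)%VS -> U = fullv.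
Proof. by move=> s; apply/eqP; rewrite eqEsubv subvf s. Qed.

Definition actf (M : module A) (a : A) : 'End(M) := linfun (@act K A M a).

Lemma actfE (M : module A) a (v : M) : actf M a v = act a v.
Proof. exact: lfunE. Qed.

Lemma actl_linear (M : module A) (v : M) : linear (fun a : A => act a v).
Proof. by move=> c a b; rewrite actDl. Qed.

Lemma act0l (M : module A) (v : M) : act (0 : A) v = 0.
Proof. by have := actDl 1 0 0 v; rewrite !scale1r addr0 -{1}[act 0 v]addr0 => /addrI. Qed.

Lemma actZl (M : module A) c a (v : M) : act (c *: a) v = c *: act a v.
Proof. by have := actDl c a 0 v; rewrite addr0 act0l addr0. Qed.

Lemma actDl1 (M : module A) a b (v : M) : act (a + b) v = act a v + act b v.
Proof. by have := actDl 1 a b v; rewrite !scale1r. Qed.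

Lemma actZr (M : module A) c a (v : M) : act a (c *: v) = c *: act a v.
Proof. by rewrite linearZ. Qed.

Lemma actBr (M : module A) a (v w : M) : act a (v - w) = act a v - act a w.
Proof. by rewrite linearB. Qed.

Lemma act_suml (M : module A) I (r : seq I) P (F : I -> A) (v : M) :
  act (\sum_(i <- r | P i) F i) v = \sum_(i <- r | P i) act (F i) v.
Proof.
by apply: (big_morph (fun a => act a v)) => [a b|]; rewrite ?actDl1 ?act0l.
Qed.

Definition actv (M : module A) (v : M) : 'Hom(A, M) :=
  linfun (HB.pack_for {linear A -> M} (fun a : A => act a v)
    (GRing.isLinear.Build K A M _ _ (actl_linear v))).

Lemma actvE (M : module A) (v : M) a : actv v a = act a v.
Proof. by rewrite lfunE. Qed.

Lemma submodule_eq (M : module A) (U W : submodule M) :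
  sub_space U = sub_space W -> U = W.
Proof. exact: val_inj. Qed.

Lemma stable_sub (M : module A) (U : submodule M) a v :
  v \in (U : {vspace M}) -> act a v \in (U : {vspace M}).
Proof. exact: stableP. Qed.

(* [g] is A-linear on U only: it encodes a surjection U -> N with kernel W without
   going through the types [submod U] and [subquot U W]. *)
Definition presents (M N : module A) (U W : {vspace M}) (g : 'Hom(M, N)) :=
  [/\ forall a u, u \in U -> g (act a u) = act a (g u),
      (g @: U = fullv)%VS & (U :&: lker g = W)%VS].

Lemma presents_eq0 (M N : module A) (U W : {vspace M}) (g : 'Hom(M, N)) u :
  presents U W g -> u \in U -> (g u == 0) = (u \in W).
Proof. by move=> [_ _ <-] Uu; rewrite memv_cap Uu memv_ker. Qed.

(** The inverse [f^-1] only picks some preimage in U. As g and g' have the same kernel on U, the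
    value of g' does not depend on that choice, which makes [h] A-linear and bijective. *)
Lemma presents_iso (M N N' : module A) (U : submodule M) (W : {vspace M})
    (g : 'Hom(M, N)) (g' : 'Hom(M, N')) :
  presents U W g -> presents U W g' -> iso N N'.
Proof.
move=> [gh gs gk] [gh' gs' gk'].
pose i : 'Hom(subvs_of U, M) := linfun vsval.
pose f := (g \o i)%VF.
pose h := (g' \o i \o f^-1)%VF.
have iE u : i u = vsval u by rewrite lfunE.
have fs : limg f = fullv.
  apply: eq_fullv; rewrite -gs; apply/subvP => _ /memv_imgP[u Uu ->].
  apply/memv_imgP; exists (vsproj U u); rewrite ?memvf // comp_lfunE iE vsprojK //.
have hg u : u \in (U : {vspace M}) -> h (g u) = g' u.
  move=> Uu; rewrite /h !comp_lfunE iE.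
  set x := (f^-1)%VF (g u).
  have fx : g (vsval x) = g u.
    by rewrite -[RHS](@limg_lfunVK _ _ _ f) ?fs ?memvf // comp_lfunE iE.
  apply/eqP; rewrite -subr_eq0 -linearB /= -memv_ker.
  have: vsval x - u \in (U :&: lker g)%VS.
    by rewrite memv_cap memvB ?subvsP // memv_ker linearB /= fx subrr eqxx.
  by rewrite gk -gk' memv_cap => /andP[].
have gU w : exists2 u, u \in (U : {vspace M}) & w = g u.
  by apply/memv_imgP; rewrite gs memvf.
have hh a w : h (act a w) = act a (h w).
  have [u Uu ->] := gU w; rewrite -gh // !hg ?gh' //; exact: stable_sub.
exists (Defs.Hom hh); split.
  apply/eqP; rewrite -subv0; apply/subvP => w; rewrite memv_ker memv0 /=.
  have [u Uu ->] := gU w; rewrite hg // -memv_ker => ku.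
  have: u \in (U :&: lker g')%VS by rewrite memv_cap Uu.
  by rewrite gk' -gk memv_cap memv_ker => /andP[].
apply: eq_fullv; rewrite -gs'; apply/subvP => _ /memv_imgP[u Uu ->].
by rewrite -hg // memv_img ?memvf.
Qed.

Lemma presents_comp (M N N' : module A) (U W : {vspace M}) (g : 'Hom(M, N))
    (f : modhom N N') (Uf : embedding f) (sf : surjection f) :
  presents U W g -> presents U W (f \o g)%VF.
Proof.
move=> [gh gs gk]; split.
- by move=> a u Uu; rewrite !comp_lfunE gh // hom_act.
- by rewrite limg_comp gs.
rewrite -gk; apply/vspaceP => v; rewrite !memv_cap !memv_ker comp_lfunE /=.
congr (_ && _); rewrite -memv_ker; move: Uf; rewrite /embedding => ->.
by rewrite memv0.
Qed.

Lemma presents_id (M : module A) : presents fullv 0%VS (\1%VF : 'End(M)).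
Proof.
split=> [a u _||]; rewrite ?id_lfunE //.
  by apply: eq_fullv; apply/subvP => v _; rewrite -[v]id_lfunE memv_img ?memvf.
by apply/vspaceP => v; rewrite memv_cap memvf memv_ker id_lfunE memv0.
Qed.

Lemma presents_modhom (M N : module A) (f : modhom M N) :
  surjection f -> presents fullv (lker f) f.
Proof. by move=> sf; split=> [a u _||]; rewrite ?hom_act // capfv. Qed.

Lemma iso_of_presents (M N : module A) (g : 'Hom(M, N)) :
  presents fullv 0%VS g -> iso M N.
Proof. by apply: (presents_iso (U := subT M)); apply: presents_id. Qed.

Lemma presents_of_iso (M N : module A) :
  iso M N -> exists g : 'Hom(M, N), presents fullv 0%VS g.
Proof.
by move=> [f [ef sf]]; exists f; rewrite -{1}ef; apply: presents_modhom.
Qed.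

Lemma iso_sym (M N : module A) : iso M N -> iso N M.
Proof.
move=> /presents_of_iso[g gP].
by apply: (presents_iso (U := subT M) gP); apply: presents_id.
Qed.

Lemma presents_isor (M N N' : module A) (U W : {vspace M}) (g : 'Hom(M, N)) :
  presents U W g -> iso N N' -> exists g' : 'Hom(M, N'), presents U W g'.
Proof. by move=> gP [f [ef sf]]; exists (f \o g)%VF; apply: presents_comp. Qed.

Lemma iso_trans (M N P : module A) : iso M N -> iso N P -> iso M P.
Proof.
move=> /presents_of_iso[g gP] /(presents_isor gP)[g' g'P].
exact: iso_of_presents g'P.
Qed.

Section Quot.
Variables (M : module A) (U : submodule M).

HB.instance Definition _ := GRing.isLinear.Build K M (subvs_of (U^C)%VS) _
  (@quot_map K A M U) (@quot_map_linear K A M U).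

Definition quotf : 'Hom(M, quotmod U) := linfun (@quot_map K A M U).

Lemma quotfE v : quotf v = quot_map U v.
Proof. by rewrite lfunE. Qed.

Lemma quotf_surj (w : quotmod U) : exists v, w = quotf v.
Proof. by exists (quot_rep w); rewrite quotfE quot_repK. Qed.

Lemma quotf_eq0 v : (quotf v == 0) = (v \in (U : {vspace M})).
Proof.
rewrite quotfE; apply/eqP/idP => [v0|]; last exact: quot_map_eq0.
have := quot_decomp U v; rewrite v0.
by have -> : quot_rep (0 : subvs_of (U^C)%VS) = 0 := linear0 _; rewrite subr0.
Qed.

Lemma quotf_act a v : quotf (act a v) = act a (quotf v).
Proof. by rewrite !quotfE quot_map_act. Qed.

Lemma presents_quot : presents fullv U quotf.
Proof.
split=> [a u _||]; first exact: quotf_act.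
  apply: eq_fullv; apply/subvP => w _.
  by have [v ->] := quotf_surj w; rewrite memv_img ?memvf.
by apply/vspaceP => v; rewrite memv_cap memvf memv_ker quotf_eq0.
Qed.

Definition subf : 'Hom(M, submod U) := linfun (vsproj U).

Lemma subfK v : v \in (U : {vspace M}) -> vsval (subf v) = v.
Proof. by move=> Uv; rewrite lfunE /= vsprojK. Qed.

Lemma subf_act a v : v \in (U : {vspace M}) -> subf (act a v) = act a (subf v).
Proof.
by move=> Uv; apply: subvs_inj; rewrite /= submod_actE !subfK //; apply: stable_sub.
Qed.

Lemma presents_sub : presents U 0%VS subf.
Proof.
split=> [a u||]; first exact: subf_act.
  apply: eq_fullv; apply/subvP => w _.
  rewrite -[w](vsvalK); have -> : vsproj U (vsval w) = subf (vsval w) by rewrite lfunE.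
  by rewrite memv_img ?subvsP.
apply/vspaceP => v; rewrite memv_cap memv0 memv_ker; apply/andP/eqP => [[Uv /eqP v0]|->].
  by rewrite -[v]subfK // v0 linear0.
by rewrite mem0v linear0 eqxx.
Qed.

End Quot.

(** Passes from the quotient type to a map defined on all of M, so that elements of U need no
    coercion. *)
Lemma presents_subquot (M : module A) (U W : submodule M) : (W <= U)%VS ->
  exists g : 'Hom(M, subquot U W), presents U W g.
Proof.
move=> sWU; exists (quotf (sub_in U W) \o subf U)%VF.
have sinE v : v \in (U : {vspace M}) ->
    (subf U v \in (sub_in U W : {vspace submod U})) = (v \in (W : {vspace M})).
  by move=> Uv; rewrite -memv_preim lfunE /= subfK.
split.
- by move=> a u Uu; rewrite !comp_lfunE subf_act // quotf_act.
- rewrite limg_comp; have [_ -> _] := presents_sub U.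
  by have [_ -> _] := presents_quot (sub_in U W).
apply/vspaceP => v; rewrite memv_cap memv_ker comp_lfunE quotf_eq0.
case Uv: (v \in (U : {vspace M})); first by rewrite sinE.
by apply/esym/negbTE; apply: contraFN Uv => /(subvP sWU).
Qed.

Lemma iso_subquotP (M N : module A) (U W : submodule M) : (W <= U)%VS ->
  iso (subquot U W) N <-> exists g : 'Hom(M, N), presents U W g.
Proof.
move=> /presents_subquot[g gP]; split=> [/(presents_isor gP)//|[g' g'P]].
exact: presents_iso gP g'P.
Qed.

Lemma iso_submodP (M N : module A) (U : submodule M) :
  iso (submod U) N <-> exists g : 'Hom(M, N), presents U 0%VS g.
Proof.
have gP := presents_sub U; split=> [/(presents_isor gP)//|[g' g'P]].
exact: presents_iso gP g'P.
Qed.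

Lemma iso_quotmodP (M N : module A) (U : submodule M) :
  iso (quotmod U) N <-> exists g : 'Hom(M, N), presents fullv U g.
Proof.
have gP := presents_quot U; split=> [/(presents_isor gP)//|[g' g'P]].
exact: (@presents_iso _ _ _ (subT M)) gP g'P.
Qed.

(** At a vertex idempotent this is a Jordan-Hölder multiplicity, see [JH_multE]. It takes subspaces
    of M, so that submodules of M are compared inside M. *)
Definition cdim (e : A) (M : module A) (U : {vspace M}) := \dim (actf M e @: U)%VS.

Section Idempotent.
Variables (e : A) (ee : e * e = e).

Lemma actee (M : module A) (v : M) : act e (act e v) = act e v.
Proof. by rewrite -actM ee. Qed.

Lemma memv_eimg (M : module A) (U : {vspace M}) v : stable U ->
  (v \in (actf M e @: U)%VS) = (v \in U) && (act e v == v).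
Proof.
move=> sU; apply/memv_imgP/andP => [[u Uu ->]|[Uv /eqP ev]].
  by rewrite actfE actee sU.
by exists v; rewrite // actfE ev.
Qed.

Lemma cdimS (M : module A) (U W : {vspace M}) : (U <= W)%VS -> (cdim e U <= cdim e W)%N.
Proof. by move=> sUW; apply: dimvS; apply: limgS. Qed.

(** Exactness of M -> eM: as e is idempotent, eU consists of the e-fixed vectors of U, hence meets
    ker g in eW, and g maps it onto eN. *)
Lemma cdim_presents (M N : module A) (U W : submodule M) (g : 'Hom(M, N)) :
  presents U W g -> cdim e U = (cdim e W + cdim e (fullv : {vspace N}))%N.
Proof.
move=> [gh gs gk]; rewrite /cdim -(limg_ker_dim g (actf M e @: U)%VS).
have -> : (actf M e @: U :&: lker g)%VS = (actf M e @: W)%VS.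
  apply/vspaceP => v; rewrite memv_cap !memv_eimg; try exact: stableP.
  by rewrite -[sub_space W]gk memv_cap -!andbA; congr (_ && _); rewrite andbC.
have -> // : (g @: (actf M e @: U) = actf N e @: fullv)%VS.
apply/vspaceP => w; apply/memv_imgP/memv_imgP => [[v + ->]|[w' _ ->]].
  rewrite memv_eimg; last exact: stableP.
  by case/andP=> Uv /eqP ev; exists (g v); rewrite ?memvf // actfE -gh // ev.
have: w' \in (g @: U)%VS by rewrite gs memvf.
case/memv_imgP=> u Uu ->; exists (act e u); last by rewrite actfE -gh.
by rewrite -actfE memv_img.
Qed.

Lemma cdim0 (M : module A) : cdim e (0%VS : {vspace M}) = 0%N.
Proof. by rewrite /cdim limg0 dimv0. Qed.

Lemma cdim_iso (M N : module A) : iso M N ->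
  cdim e (fullv : {vspace M}) = cdim e (fullv : {vspace N}).
Proof.
move=> /presents_of_iso[g gP].
by rewrite (@cdim_presents M N (subT M) (sub0 M) g gP) cdim0.
Qed.

Lemma cdim_subquot (M : module A) (U W : submodule M) : (W <= U)%VS ->
  cdim e U = (cdim e W + cdim e (fullv : {vspace subquot U W}))%N.
Proof. by move=> /presents_subquot[g /cdim_presents]. Qed.

Lemma cdim_submod (M : module A) (U : submodule M) :
  cdim e (fullv : {vspace submod U}) = cdim e U.
Proof.
by rewrite (@cdim_presents M (submod U) U (sub0 M) (subf U)) ?cdim0 //; apply: presents_sub.
Qed.

Lemma cdim_quotmod (M : module A) (U : submodule M) :
  cdim e (fullv : {vspace M}) = (cdim e U + cdim e (fullv : {vspace quotmod U}))%N.
Proof.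
by rewrite (@cdim_presents M (quotmod U) (subT M) U (quotf U)) //; apply: presents_quot.
Qed.

Lemma eimg_eq (M : module A) (U W : {vspace M}) : stable U -> (U <= W)%VS ->
  (cdim e W <= cdim e U)%N -> (actf M e @: W <= U)%VS.
Proof.
move=> sU sUW; rewrite /cdim => le; have /eqP : (actf M e @: U == actf M e @: W)%VS.
  by rewrite eqEdim le limgS.
move=> <-; apply/subvP => v; rewrite memv_eimg // => /andP[]//.
Qed.

End Idempotent.

Section Generated.
Variable M : module A.

(** The submodule A W. By linearity in A a basis suffices, which keeps it a finite sum of
    subspaces. *)
Definition gen (W : {vspace M}) : {vspace M} :=
  (\sum_(i < \dim {:A}) actf M (vbasis {:A})`_i @: W)%VS.

Lemma mem_gen (W : {vspace M}) a (w : M) : w \in W -> act a w \in gen W.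
Proof.
move=> Ww; rewrite (coord_vbasis (memvf a)) act_suml; apply: memv_suml => i _.
rewrite actZl; apply: memvZ.
by apply: (subvP (sumv_sup i _ (subvv _))) => //; rewrite -actfE memv_img.
Qed.

Lemma gen_subP (W U : {vspace M}) :
  reflect (forall a (w : M), w \in W -> act a w \in U) (gen W <= U)%VS.
Proof.
apply: (iffP idP) => [s a w Ww|s]; first by apply: (subvP s); apply: mem_gen.
by apply/subv_sumP => i _; apply/subvP => _ /memv_imgP[w Ww ->]; rewrite actfE s.
Qed.

Lemma stable_gen (W : {vspace M}) : stable (gen W).
Proof.
move=> a; suff s : (gen W <= actf M a @^-1: gen W)%VS.
  by move=> v /(subvP s); rewrite -memv_preim actfE.
by apply/gen_subP => b w Ww; rewrite -memv_preim actfE -actM mem_gen.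
Qed.

Definition gensub W : submodule M := Sub_module (@stable_gen W).

(** A e U; for a submodule U this is the trace of the projective A e in U, the sum of the images of
    all homomorphisms A e -> U. *)
Definition tr (e : A) (U : {vspace M}) : submodule M := gensub (actf M e @: U)%VS.

Lemma tr_subP e (U : submodule M) (W : {vspace M}) :
  reflect (forall a (u : M), u \in (U : {vspace M}) -> act (a * e) u \in W) (tr e U <= W)%VS.
Proof.
apply: (iffP (gen_subP _ _)) => s a u Uu.
  by rewrite actM s // -actfE memv_img.
by case/memv_imgP: Uu => v Uv ->; rewrite actfE -actM s.
Qed.

Lemma mem_tr e (U : {vspace M}) a u : u \in U -> act (a * e) u \in (tr e U : {vspace M}).
Proof. by move=> Uu; rewrite actM mem_gen // -actfE memv_img. Qed.

Lemma trS e (U W : {vspace M}) : (U <= W)%VS -> (tr e U <= tr e W)%VS.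
Proof.
move=> s; apply/gen_subP => a _ /memv_imgP[u Uu ->].
by rewrite actfE -actM mem_tr // (subvP s).
Qed.

Lemma tr_sub e (U : submodule M) : (tr e U <= U)%VS.
Proof. by apply/tr_subP => a u Uu; apply: stable_sub. Qed.

Lemma tr_eimg_sub e (U : submodule M) (W : {vspace M}) : stable W ->
  (actf M e @: U <= W)%VS -> (tr e U <= W)%VS.
Proof. by move=> sW s; apply/gen_subP => a w /(subvP s); apply: sW. Qed.

(** The vectors v with e A v = 0, which form the largest submodule killed by e. A basis of A
    suffices, as for [gen]. *)
Definition rej (e : A) : {vspace M} :=
  (\bigcap_(i < \dim {:A}) lker (actf M (e * (vbasis {:A})`_i)%R))%VS.

Lemma rejP e v : reflect (forall a, act (e * a) v = 0) (v \in rej e).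
Proof.
apply: (iffP subv_bigcapP) => [s a|s i _]; last first.
  by rewrite -memvE memv_ker actfE s.
rewrite (coord_vbasis (memvf a)) mulr_sumr act_suml big1 // => i _.
by rewrite -scalerAr actZl; have := s i isT; rewrite -memvE memv_ker actfE => /eqP->; rewrite scaler0.
Qed.

Lemma stable_rej e : stable (rej e).
Proof. by move=> a v /rejP s; apply/rejP => b; rewrite -actM -mulrA s. Qed.

Definition rejs e : submodule M := Sub_module (@stable_rej e).

Lemma sub_rej e (U : submodule M) : (actf M e @: U)%VS = 0%VS -> (U <= rej e)%VS.
Proof.
move=> eU; apply/subvP => v Uv; apply/rejP => a; apply/eqP.
by rewrite -memv0 -eU actM -actfE memv_img // stable_sub.
Qed.

End Generated.

End LinearMaps.

(** * The coefficient of a trivial path as a character of KQ *)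

Section PathAlgebraFacts.
Variables (K : fieldType) (V : finType) (Q : quiver V).
Local Notation KQ := (path_algebra Q K).

Definition vtx (i : V) (x : KQ) : K := x@_(trivial_path Q i).

Lemma vtxP i c (x y : KQ) : vtx i (c *: x + y) = c * vtx i x + vtx i y.
Proof. by rewrite /vtx mcoeffD mcoeffZ. Qed.
HB.instance Definition _ i := GRing.isLinear.Build K KQ K _ (vtx i) (vtxP i).

Lemma vtx_path i p : vtx i (path_of K p) = (p == trivial_path Q i)%:R.
Proof. by rewrite [LHS]mcoeffU. Qed.

Lemma path_mul p q : path_of K p * path_of K q = @pbasis V Q K (Defs.pcomp p q).
Proof. by rewrite [LHS]/(pmul _ _) /pmul !pextU. Qed.

Lemma path_ind (P : KQ -> Prop) : P 0 -> (forall c x y, P x -> P y -> P (c *: x + y)) ->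
  (forall p, P (path_of K p)) -> forall x, P x.
Proof.
move=> P0 PD Pp x; rewrite [x]pextE /pext.
by apply: big_rec => [|p y _ Py]; [exact: P0 | apply: PD => //; apply: Pp].
Qed.

Lemma pextZ f c (x : KQ) : pext f (c *: x) = c *: pext f x.
Proof. by rewrite linearZ. Qed.

Lemma path_scaleAl c (x y : KQ) : (c *: x) * y = c *: (x * y).
Proof. by rewrite -[LHS]/(pmul (c *: x) y) /pmul linearZ. Qed.

Lemma pext_scale f c (x : KQ) : pext (fun p => c *: f p) x = c *: pext f x.
Proof.
rewrite /pext scaler_sumr; apply: eq_bigr => p _.
by rewrite [LHS]scalerA [RHS]scalerA mulrC.
Qed.

Lemma path_scaleAr c (x y : KQ) : x * (c *: y) = c *: (x * y).
Proof.
rewrite -[LHS]/(pmul x (c *: y)) -[x * y]/(pmul x y) /pmul -pext_scale.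
by apply: eq_pext => p; rewrite pextZ.
Qed.

(** A composite of two paths is the trivial path at i exactly when both factors are. *)
Lemma vtxM i x y : vtx i (x * y) = vtx i x * vtx i y.
Proof.
elim/path_ind: x => [|c x x' ex ex'|p]; first by rewrite mul0r linear0 mul0r.
  have -> : (c *: x + x') * y = c *: (x * y) + x' * y by rewrite -path_scaleAl; exact: mulrDl.
  rewrite (vtxP i c x x') mulrDl -mulrA.
  exact: etrans (vtxP i c (x * y) (x' * y)) (f_equal2 (fun s t => c * s + t) ex ex').
elim/path_ind: y => [|c y y' ey ey'|q]; first by rewrite mulr0 linear0 mulr0.
  have -> : path_of K p * (c *: y + y') = c *: (path_of K p * y) + path_of K p * y'.
    by rewrite -path_scaleAr; exact: mulrDr.
  rewrite (vtxP i c y y') mulrDr mulrCA.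
  exact: etrans (vtxP i c _ _) (f_equal2 (fun s t => c * s + t) ey ey').
apply: etrans (f_equal (vtx i) (path_mul p q)) _.
apply: etrans _ (esym (f_equal2 *%R (vtx_path i p) (vtx_path i q))).
case E: (Defs.pcomp p q) => [r|]; last first.
  rewrite [LHS]linear0; case: eqP => [ep|]; last by rewrite mul0r.
  case: eqP => [eq|]; last by rewrite mulr0.
  by move: (pcomp_none E); rewrite ep eq eqxx.
rewrite [LHS]vtx_path; have [e1 vr sr er] := pcomp_end E.
rewrite -natrM mulnb; congr (_%:R); congr nat_of_bool; apply/eqP/andP => [er0|[/eqP ep /eqP eq]].
  (* A trivial composite has no arrows, so neither factor has any; the matching endpoints then place
     both at i. *)
  have : (val q).2 ++ (val p).2 = [::] by move: vr; rewrite er0 => /(congr1 snd).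
  case Ep: (val p) => [a s]; case Eq: (val q) => [b s'] /=.
  case: s' Eq => // Eq /= s0; rewrite s0 in Ep.
  have bi : b = i by move: sr; rewrite er0 /pstart Eq.
  have ai : a = i by move: e1; rewrite /pstart /pend Ep Eq /= => /eqP; rewrite bi.
  by split; apply/eqP/val_inj; rewrite ?Ep ?Eq ?ai ?bi.
by apply: val_inj; rewrite vr ep eq.
Qed.

Lemma arrow_ideal_vtx x : arrow_ideal x -> forall i, vtx i x = 0.
Proof.
move=> /(_ [set x | forall i, vtx i x = 0]); apply.
  split=> [i|y z y0 z0 i|a y y0 i|a y y0 i] /=; first by rewrite linear0.
  - by rewrite linearD /= y0 z0 addr0.
  - by rewrite vtxM y0 mulr0.
  - by rewrite vtxM y0 mul0r.
by move=> _ [a _ <-] i /=; rewrite vtx_path; case: eqP => // /(congr1 val).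
Qed.

Lemma ideal_pow2_vtx x : ideal_pow (@arrow_ideal K V Q) 2 x -> forall i, vtx i x = 0.
Proof.
move=> /(_ [set x | forall i, vtx i x = 0]); apply.
  split=> [i|y z y0 z0 i|a y y0 i|a y y0 i] /=; first by rewrite linear0.
  - by rewrite linearD /= y0 z0 addr0.
  - by rewrite vtxM y0 mulr0.
  - by rewrite vtxM y0 mul0r.
by move=> _ [y [z [/arrow_ideal_vtx y0 _ ->]]] i; rewrite vtxM y0 mul0r.
Qed.

Lemma ideal_pow_arrow n (a : arrow Q) x : ideal_pow (@arrow_ideal K V Q) n x ->
  ideal_pow (@arrow_ideal K V Q) n.+1 (path_of K (arrow_path a) * x).
Proof.
move=> xn J Jid; apply; exists (path_of K (arrow_path a)), x; split=> //.
by move=> J' J'id; apply; exists a.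
Qed.

Lemma sum_trivial_path : \sum_i path_of K (trivial_path Q i) = 1.
Proof. by []. Qed.

(** Arrows compose like functions, so the first arrow traversed is the right factor, the one that
    acts first on a module. *)
Lemma path_cases (p : qpath Q) : (exists i, p = trivial_path Q i) \/
  exists q a, path_of K p = path_of K q * path_of K (arrow_path a).
Proof.
case: p => -[i [|a s]] wp; first by left; exists i; apply: val_inj.
right; have /andP[/eqP ia ws] := wp.
pose q : qpath Q := exist _ (tgt a, s) ws; exists q, a.
have e : pstart q == pend (arrow_path a) := eqxx _.
apply: etrans _ (esym (path_mul _ _)); rewrite (pcompT e).
by congr (path_of K _); apply: val_inj; rewrite /= /raw_comp /= ia.
Qed.

End PathAlgebraFacts.

Local Opaque vtx path_of.

(* [idem phi i], sealed: unification unfolds the latter down to finite maps *)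
Definition vid (K : fieldType) (d : Order.disp_t) (V : finPOrderType d) (Q : quiver V)
  (A : falgType K) (phi : {rmorphism path_algebra Q K -> A}) : V -> A := locked (idem phi).

Lemma vidE (K : fieldType) (d : Order.disp_t) (V : finPOrderType d) (Q : quiver V)
  (A : falgType K) (phi : {rmorphism path_algebra Q K -> A}) i : idem phi i = vid phi i.
Proof. by rewrite /vid -lock. Qed.

(** * Characters of A, simple modules and Jordan-Hölder multiplicities *)

Section Characters.
Variables (K : fieldType) (d : Order.disp_t) (V : finPOrderType d) (Q : quiver V).
Local Notation KQ := (path_algebra Q K).
Variables (A : falgType K) (phi : {rmorphism KQ -> A}).
Hypothesis hA : bound_quiver_algebra phi.
Local Notation idem := (vid phi).

Lemma phi_lift a : {x | phi x = a}.
Proof. by apply: cid; have [_ s _] := hA; apply: s. Qed.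

Lemma phi_scale c x : phi (c *: x) = c *: phi x.
Proof. by have [s _ _] := hA; apply: s. Qed.

(* the character of A afforded by S(i) *)
Definition chi (i : V) (a : A) : K := vtx i (projT1 (phi_lift a)).

(** Independence of the chosen lift: two lifts differ by an element of the square of the arrow
    ideal, where [vtx i] vanishes. *)
Lemma chi_phi i x : chi i (phi x) = vtx i x.
Proof.
apply/eqP; rewrite -subr_eq0 -linearB /=; apply/eqP.
apply: ideal_pow2_vtx; have [_ _ [_ [m _ [_ s]]]] := hA; apply: s => /=.
by rewrite rmorphB /= (projT2 (phi_lift (phi x))) subrr.
Qed.

Lemma chiP i c a b : chi i (c *: a + b) = c * chi i a + chi i b.
Proof.
have [[x <-] [y <-]] := (phi_lift a, phi_lift b).
by rewrite -phi_scale -rmorphD /= !chi_phi vtxP.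
Qed.
HB.instance Definition _ i := GRing.isLinear.Build K A K _ (chi i) (chiP i).

Lemma chiM i a b : chi i (a * b) = chi i a * chi i b.
Proof.
have [[x <-] [y <-]] := (phi_lift a, phi_lift b).
by rewrite -rmorphM /= !chi_phi vtxM.
Qed.

Lemma trivial_path_eq i k : (trivial_path Q i == trivial_path Q k) = (i == k).
Proof. by apply/eqP/eqP => [/(congr1 val)[]|->]. Qed.

Lemma chi_idem i k : chi i (idem k) = (k == i)%:R.
Proof. by rewrite -vidE; apply: etrans (chi_phi _ _) _; rewrite vtx_path trivial_path_eq. Qed.

Lemma chi_arrow i (a : arrow Q) : chi i (phi (path_of K (arrow_path a))) = 0.
Proof. by rewrite chi_phi vtx_path; case: eqP => // /(congr1 val). Qed.

Lemma idemM i k : idem i * idem k = if i == k then idem k else 0.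
Proof.
rewrite -!vidE /Defs.idem -rmorphM /= (path_mul K (trivial_path Q i) (trivial_path Q k)).
by rewrite pcompp1 -[pstart _]/i; case: eqP => [->|]; rewrite ?rmorph0.
Qed.

Lemma idemee i : idem i * idem i = idem i.
Proof. by rewrite idemM eqxx. Qed.

Lemma sum_idem : \sum_i idem i = 1.
Proof.
rewrite (eq_bigr (Defs.idem phi)) => [|i _]; last by rewrite vidE.
by rewrite -(rmorph1 phi) -sum_trivial_path rmorph_sum. Qed.

Definition arr (a : arrow Q) : A := phi (path_of K (arrow_path a)).

Lemma arr_idem a i : arr a * idem i = if src a == i then arr a else 0.
Proof.
rewrite -vidE /arr /Defs.idem -rmorphM /= (path_mul K (arrow_path a) (trivial_path Q i)).
by rewrite pcompp1 -[pstart _]/(src a); case: eqP => _; rewrite ?rmorph0.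
Qed.

(** Every path is trivial or has an arrow as its right factor. The arrows kill w, and among trivial
    paths only that at i acts on w as nonzero. *)
Lemma chi_act (M : module A) i (w : M) : act (idem i) w = w ->
  (forall a : arrow Q, act (arr a) w = 0) -> forall a, act a w = chi i a *: w.
Proof.
move=> iw aw a; have [x <-] := phi_lift a; rewrite chi_phi.
elim/path_ind: x => [|c x y ex ey|p].
- by rewrite rmorph0 act0l [vtx i 0]linear0 scale0r.
- rewrite rmorphD /= phi_scale actDl vtxP scalerDl -scalerA.
  exact: (f_equal2 (fun s t => c *: s + t) ex ey).
case: (path_cases K p) => [[k ->]|[q [b ->]]].
  rewrite vtx_path trivial_path_eq -[phi _]/(Defs.idem phi k) vidE -{1}iw -actM idemM.
  by case: eqP => _; rewrite ?iw ?scale1r // act0l scale0r.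
apply: etrans (f_equal (fun a => act a w) (rmorphM phi _ _)) _.
apply: etrans (actM _ _ _) _; apply: etrans (f_equal (act _) (aw b)) _.
rewrite act0; apply/esym; apply: etrans (f_equal (fun s => s *: w) (vtxM i (path_of K q) (path_of K (arrow_path b)))) _.
have b0 : vtx i (path_of K (arrow_path b)) = 0.
  by apply: etrans (vtx_path _ _ _) _; case: eqP => // /(congr1 val).
apply: etrans (f_equal (fun s => (vtx i (path_of K q) * s) *: w) b0) _.
by rewrite mulr0 scale0r.
Qed.

(** If no nonzero vector were killed by all arrows, then starting from v one could apply arrows
    forever without reaching 0; but a power of the arrow ideal lies in ker [phi]. *)
Lemma eigenvector (M : module A) : (fullv : {vspace M}) <> 0%VS ->
  exists i (w : M), w != 0 /\ forall a, act a w = chi i a *: w.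
Proof.
move=> M0; pose v := vpick (fullv : {vspace M}).
have v0 : v != 0 by rewrite vpick0; apply/eqP.
suff [w w0 aw] : exists2 w : M, w != 0 & forall a : arrow Q, act (arr a) w = 0.
  (* The e_i sum to 1, so some e_i w survives. It is still killed by the arrows, because an arrow
     times e_i is that arrow or 0. *)
  have [i iw0] : exists i, act (idem i) w != 0.
    apply: contrapT => iw0; case/eqP: w0; rewrite -(act1 w) -sum_idem act_suml big1 // => i _.
    by apply/eqP; apply: contra_notT iw0 => iw; exists i.
  exists i, (act (idem i) w); split=> //; apply: chi_act => [|a].
    by rewrite -actM idemee.
  by rewrite -actM arr_idem; case: ifP => _; rewrite ?act0l.
apply: contrapT => no.
have {}no (w : M) : w != 0 -> exists a : arrow Q, act (arr a) w != 0.
  move=> w0; apply: contrapT => aw; apply: no; exists w => // a; apply/eqP.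
  by apply: contra_notT aw => awa; exists a.
have pow n : exists2 x, ideal_pow (@arrow_ideal K V Q) n x & act (phi x) v != 0.
  elim: n => [|n [x xn xv]]; first by exists 1; rewrite ?rmorph1 ?act1.
  have [a av] := no _ xv; exists (path_of K (arrow_path a) * x).
    exact: ideal_pow_arrow.
  by rewrite rmorphM actM.
have [_ _ [_ [m _ [s _]]]] := hA.
by have [x /s /= x0] := pow m; rewrite x0 act0l eqxx.
Qed.

(** Describes the isomorphism class of S(i) intrinsically; [Smod] is one realization of it. *)
Definition chi_module (i : V) (N : module A) :=
  \dim (fullv : {vspace N}) = 1%N /\ forall a (v : N), act a v = chi i a *: v.

Lemma chi_module_line i (N : module A) (w : N) : w != 0 -> <[w]>%VS = fullv ->
  (forall a, act a w = chi i a *: w) -> chi_module i N.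
Proof.
move=> w0 wf aw; split; first by rewrite -wf dim_vline w0.
move=> a v; have /vlineP[c ->] : v \in <[w]>%VS by rewrite wf memvf.
by rewrite actZr aw !scalerA mulrC.
Qed.

(** Both modules are quotients of the regular module by the same left ideal, the kernel of
    [chi i]. *)
Lemma chi_module_iso i (N N' : module A) : chi_module i N -> chi_module i N' -> iso N N'.
Proof.
have pr (E : module A) : chi_module i E -> exists2 g : 'Hom(regular A, E),
    presents fullv (lker g) g & forall a : A, (g a == 0) = (chi i a == 0).
  move=> [d1 cE]; pose b := vpick (fullv : {vspace E}).
  have b0 : b != 0 by rewrite vpick0 -dimv_eq0 d1.
  exists (actv b); last by move=> a; rewrite actvE cE scaler_eq0 (negPf b0) orbF.
  split=> [a u _||]; rewrite ?capfv //; first by rewrite !actvE /= actM.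
  have bf : <[b]>%VS = fullv by apply/eqP; rewrite eqEdim subvf dim_vline b0 d1.
  apply: eq_fullv; rewrite -[X in (X <= _)%VS]bf -memvE.
  by apply/memv_imgP; exists 1; rewrite ?memvf // actvE act1.
move=> /pr[g gP gE] /pr[g' gP' gE'].
apply: (@presents_iso K A (regular A) _ _ (subT _) (lker g) g g' gP).
suff -> : lker g = lker g' by [].
by apply/vspaceP => a; rewrite !memv_ker gE gE'.
Qed.

Lemma cdim_chi i k (N : module A) : chi_module i N ->
  cdim (idem k) (fullv : {vspace N}) = (k == i).
Proof.
move=> [d1 cN]; rewrite /cdim.
have -> : (actf N (idem k) @: fullv)%VS = if k == i then fullv else 0%VS.
  case: eqP => [->|/eqP ki].
    apply: eq_fullv; apply/subvP => v _; apply/memv_imgP; exists v; rewrite ?memvf //.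
    by rewrite actfE cN chi_idem eqxx scale1r.
  apply/eqP; rewrite -subv0; apply/subvP => _ /memv_imgP[v _ ->].
  by rewrite actfE cN chi_idem (negPf ki) scale0r mem0v.
by case: eqP; rewrite ?dimv0.
Qed.

Definition chif i : 'Hom(A, K^o) := linfun (chi i : A -> K^o).

Lemma mem_chif i a : (a \in lker (chif i)) = (chi i a == 0).
Proof. by rewrite memv_ker lfunE. Qed.

Lemma prodv_chifl i (U W : {vspace A}) : (U <= lker (chif i))%VS -> (U * W <= lker (chif i))%VS.
Proof.
move=> /subvP s; apply/prodvP => u w /s; rewrite !mem_chif => /eqP u0 _.
by rewrite chiM u0 mul0r.
Qed.

Lemma prodv_chifr i (U W : {vspace A}) : (W <= lker (chif i))%VS -> (U * W <= lker (chif i))%VS.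
Proof.
move=> /subvP s; apply/prodvP => u w _ /s; rewrite !mem_chif => /eqP w0.
by rewrite chiM w0 mulr0.
Qed.

Lemma left_idealE (U : {vspace A}) : sub_space (left_ideal U) = ({:A} * U)%VS.
Proof. by []. Qed.

Lemma Aidem_sub i (U : {vspace A}) :
  (left_ideal (U * <[idem i]>)%VS <= Aidem phi i)%VS.
Proof. by rewrite /Aidem vidE !left_idealE prodvA; apply: prodvSl; apply: subvf. Qed.

Lemma mem_Aidem i (a : A) : (a \in (Aidem phi i : {vspace regular A})) = (a * idem i == a).
Proof.
rewrite /Aidem vidE; apply/idP/eqP => [|<-]; last by rewrite left_idealE memv_mul ?memvf ?memv_line.
have s : ({:A} * <[idem i]> <= fixedSpace (amulr (idem i)))%VS.
  apply/prodvP => b _ _ /vlineP[c ->]; apply/fixedSpaceP.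
  by rewrite lfunE /= -mulrA -scalerAl idemee.
by rewrite left_idealE => /(subvP s) /fixedSpaceP; rewrite lfunE.
Qed.

Lemma mem_Aidem_mul i (a : A) : a * idem i \in (Aidem phi i : {vspace regular A}).
Proof. by rewrite mem_Aidem -mulrA idemee. Qed.

Lemma arrow_space_chi i : (arrow_space phi <= lker (chif i))%VS.
Proof.
by apply/span_subvP => _ /mapP[a _ ->]; rewrite mem_chif chi_arrow.
Qed.

Lemma Smod_chi i : chi_module i (Smod phi i).
Proof.
rewrite /Smod vidE; set W := left_ideal (arrow_space phi * {:A} * <[idem i]>)%VS.
have [g [gh gs gk]] := presents_subquot (Aidem_sub i (arrow_space phi * {:A})%VS : (W <= _)%VS).
have Ue : idem i \in (Aidem phi i : {vspace regular A}) by rewrite mem_Aidem idemee.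
pose w := g (idem i).
have ga a : g (a * idem i) = act a w by rewrite -gh.
have g0 a : a \in (Aidem phi i : {vspace regular A}) -> (g a == 0) = (a \in (W : {vspace regular A})).
  by move=> aU; rewrite -gk memv_cap aU memv_ker.
have aw a : act a w = chi i a *: w.
  apply: chi_act => [|b]; first by rewrite -ga idemee.
  rewrite -ga; apply/eqP; rewrite g0 ?mem_Aidem_mul // left_idealE.
  rewrite -[X in X \in _](mul1r (arr b * idem i)) memv_mul ?memvf // memv_mul ?memv_line //.
  rewrite -[X in X \in _](mulr1 (arr b)) memv_mul ?memvf //; apply: memv_span.
  by apply/mapP; exists b; rewrite ?mem_enum.
(* The character [chi i] vanishes on J e_i but takes the value 1 on e_i. *)
have w0 : w != 0.
  rewrite g0 //; apply/negP; rewrite left_idealE => eW.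
  have s : ({:A} * (arrow_space phi * {:A} * <[idem i]>) <= lker (chif i))%VS.
    by apply/prodv_chifr/prodv_chifl/prodv_chifl/arrow_space_chi.
  by move/(subvP s): eW; rewrite mem_chif chi_idem eqxx oner_eq0.
apply: (chi_module_line w0 _ aw); apply: eq_fullv; rewrite -[X in (X <= _)%VS]gs.
apply/subvP => _ /memv_imgP[u + ->]; rewrite mem_Aidem => /eqP <-.
by rewrite ga aw; apply: memvZ; apply: memv_line.
Qed.

Lemma simple_chi (N : module A) : simple N -> exists i, chi_module i N.
Proof.
move=> [/eigenvector[i [w [w0 aw]]] sN]; exists i.
have sw : stable <[w]>%VS.
  by move=> a _ /vlineP[c ->]; rewrite actZr aw; do 2!apply: memvZ; apply: memv_line.
apply: (chi_module_line w0 _ aw); case: (sN (Sub_module sw)) => // /= /eqP.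
by rewrite -dimv_eq0 dim_vline w0.
Qed.

Lemma chi_simple i (N : module A) : chi_module i N -> simple N.
Proof.
move=> [d1 cN]; split=> [N0|U]; first by move: d1; rewrite N0 dimv0.
have := dimvS (subvf U); rewrite d1; case E: (\dim U) => [|[]] // _.
  by left; apply/eqP; rewrite -dimv_eq0 E.
by right; apply/eqP; rewrite eqEdim subvf E d1.
Qed.

Lemma filtration_cdim C (M : module A) F e : e * e = e -> filtration C F ->
  cdim e (fullv : {vspace M}) = (\sum_(k < (size F).-1)
    cdim e (fullv : {vspace subquot (nth (sub0 M) F k.+1) (nth (sub0 M) F k)}))%N.
Proof.
move=> ee [F0 Fs Fe FC].
have E t : (t <= (size F).-1)%N -> cdim e (nth (sub0 M) F t) = (\sum_(k < t)
    cdim e (fullv : {vspace subquot (nth (sub0 M) F k.+1) (nth (sub0 M) F k)}))%N.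
  elim: t => [_|t IH tF]; first by rewrite Fs big_ord0 cdim0.
  have [|le _] := FC t; first by rewrite -(prednK F0).
  by rewrite big_ord_recr /= -IH ?(ltnW tF) // (cdim_subquot ee le).
by rewrite -E // Fe.
Qed.

(** Built upwards by induction on the codimension of U: an eigenvector of M/U is lifted to v, and U
    + <v> is the next term. *)
Lemma composition_series (M : module A) : exists F : seq (submodule M), filtration (@simple K A) F.
Proof.
suff ser n (U : submodule M) : (\dim {:M} - \dim U <= n)%N -> exists s : seq (submodule M),
    last U s = subT M /\ forall k, (k < size s)%N ->
      let X := nth (sub0 M) (U :: s) k.+1 in let W := nth (sub0 M) (U :: s) k in
      (W <= X)%VS /\ simple (subquot X W).
  have [s [ls ss]] := ser _ (sub0 M) (leqnn _); exists (sub0 M :: s).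
  by split=> //; rewrite /= -?ls ?nth_last.
elim: n U => [|n IH] U dU.
  exists [::]; split=> //=; apply: submodule_eq; apply/eqP.
  by rewrite eqEdim subvf /= -subn_eq0 -leqn0.
have [Uf|Uf] := eqVneq (sub_space U) fullv.
  by exists [::]; split=> //=; apply: submodule_eq.
have [|i [w [w0 aw]]] := @eigenvector (quotmod U).
  move=> q0; case/eqP: Uf; apply: eq_fullv; apply/subvP => v _.
  by rewrite -quotf_eq0 -memv0 -q0 memvf.
have [v wv] := quotf_surj w.
have vU : v \notin (U : {vspace M}) by rewrite -quotf_eq0 -wv.
have sv : stable (U + <[v]>)%VS.
  move=> a _ /memv_addP[u Uu [_ /vlineP[c ->] ->]].
  rewrite actD actZr -[act a v](subrK (chi i a *: v)) scalerDr addrA; apply: memv_add.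
    apply: memvD; first exact: stable_sub.
    by apply: memvZ; rewrite -quotf_eq0 linearB linearZ /= quotf_act -wv aw subrr.
  by do 2!apply: memvZ; apply: memv_line.
pose X := Sub_module sv.
have UX : (U <= X)%VS by apply: addvSl.
have [|s [ls ss]] := IH X.
  have := dimvS (subvf X); have := dimvS UX.
  have : (\dim U < \dim X)%N.
    rewrite ltnNge; apply: contra vU => dX.
    have /eqP -> : (sub_space U == sub_space X) by rewrite eqEdim UX.
    by rewrite /= -[v]add0r memv_add ?mem0v ?memv_line.
  by move: dU; set a := \dim {:M}; set b := \dim U; set c := \dim X; lia.
exists (X :: s); split=> // -[_|k /ss//] /=; split=> //.
apply: (@chi_simple i); have [g [gh gs gk]] := presents_subquot UX.
have Xv : v \in (X : {vspace M}) by rewrite /= -[v]add0r memv_add ?mem0v ?memv_line.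
have g0 u : u \in (X : {vspace M}) -> (g u == 0) = (u \in (U : {vspace M})).
  by move=> Xu; rewrite -gk memv_cap Xu memv_ker.
apply: (@chi_module_line _ _ (g v)); first by rewrite g0.
  apply: eq_fullv; rewrite -[X in (X <= _)%VS]gs; apply/subvP => _ /memv_imgP[x + ->].
  case/memv_addP => u Uu [_ /vlineP[c ->] ->]; rewrite linearD linearZ /=.
  have /eqP -> : g u == 0 by rewrite g0 // (subvP UX).
  by rewrite add0r memvZ ?memv_line.
move=> a; apply/eqP; rewrite -gh // -linearZ -subr_eq0 -linearB /= g0.
  by rewrite -quotf_eq0 linearB linearZ /= quotf_act -wv aw subrr.
by rewrite memvB ?memvZ ?stable_sub.
Qed.

Lemma iso_simple_Smod (N : module A) k : simple N ->
  cdim (idem k) (fullv : {vspace N}) = `[< iso N (Smod phi k) >].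
Proof.
move=> /simple_chi[i iN]; rewrite (cdim_chi k iN); congr nat_of_bool.
apply/eqP/asboolP => [->|/(cdim_iso (idemee k))].
  exact: chi_module_iso iN (Smod_chi i).
by rewrite (cdim_chi k iN) (cdim_chi k (Smod_chi k)) eqxx; case: eqP.
Qed.

(** Each composition series gives the count dim e_k M, so the series picked by [xget] is irrelevant;
    one exists, so the default value 0 is never taken. *)
Lemma JH_multE (M : module A) k : JH_mult M (Smod phi k) = cdim (idem k) (fullv : {vspace M}).
Proof.
rewrite /JH_mult /multiplicity; case: xgetP => [m _ [F FC ->]|no].
  rewrite (filtration_cdim (idemee k) FC); apply: eq_bigr => t _.
  rewrite iso_simple_Smod //; case: FC => F0 _ _ /(_ t) [] //.
  by rewrite -ltn_predRL.
by have [F FC] := composition_series M; case: (no (factor_count F (Smod phi k))); exists F.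
Qed.

End Characters.

(** * Extremal submodules; socle and radical *)

Section Extremal.
Variables (K : fieldType) (A : falgType K) (M : module A).

(** Descent on the dimension: if U is not below some W satisfying P, then U is replaced by its
    intersection with W. Finite dimension thus stands in for infinite intersections. *)
Lemma least_exists (P : submodule M -> Prop) : P (subT M) ->
  (forall U W, P U -> P W -> P (subI U W)) -> exists U, least P U.
Proof.
move=> PT PI.
suff ex n U : P U -> (\dim U <= n)%N -> exists U0, least P U0 by exact: (ex _ _ PT (leqnn _)).
elim: n U => [|n IH] U PU dU.
  exists U; split=> // W _; move: dU; rewrite leqn0 dimv_eq0 => /eqP ->; exact: sub0v.
case: (pselect (forall W, P W -> (U <= W)%VS)) => [l|/existsNP[W /not_implyP[PW nUW]]].
  by exists U.
apply: (IH (subI U W)); first exact: PI.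
rewrite -ltnS (leq_trans _ dU) //; have := dimv_leqif_sup (capvSl U W).
move/ltn_leqif => /= ->; apply/negP => s; apply: nUW.
by apply: subv_trans s (capvSr _ _).
Qed.

Lemma greatest_exists (P : submodule M -> Prop) : P (sub0 M) ->
  (forall U W, P U -> P W -> P (subD U W)) -> exists U, greatest P U.
Proof.
move=> P0 PD.
suff ex n U : P U -> (\dim {:M} - \dim U <= n)%N -> exists U0, greatest P U0.
  exact: (ex _ _ P0 (leqnn _)).
elim: n U => [|n IH] U PU dU.
  exists U; split=> // W _; have -> : sub_space U = fullv; last exact: subvf.
  by apply/eqP; rewrite eqEdim subvf -subn_eq0 -leqn0.
case: (pselect (forall W, P W -> (W <= U)%VS)) => [l|/existsNP[W /not_implyP[PW nUW]]].
  by exists U.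
apply: (IH (subD U W)); first exact: PD.
have : (\dim U < \dim (subD U W))%N.
  rewrite (ltn_leqif (dimv_leqif_sup (addvSl U W))) /=; apply/negP => s; apply: nUW.
  by apply: subv_trans (addvSr _ _) s.
have := dimvS (subvf (subD U W)); move: dU.
set a := \dim {:M}; set b := \dim U; set c := \dim _; lia.
Qed.

Lemma maximal_exists (U : submodule M) : sub_space U <> fullv ->
  exists2 W, maximal W & (U <= W)%VS.
Proof.
suff ex n (X : submodule M) : sub_space X <> fullv -> (\dim {:M} - \dim X <= n)%N ->
    exists2 W, maximal W & (X <= W)%VS.
  by move=> Uf; apply: (ex _ _ Uf (leqnn _)).
elim: n X => [|n IH] X Xf dX.
  by case: Xf; apply/eqP; rewrite eqEdim subvf -subn_eq0 -leqn0.
case: (pselect (maximal X)) => [|nm]; first by exists X.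
have [Y [XY YX Yf]] : exists Y : submodule M, [/\ (X <= Y)%VS, sub_space Y <> X & sub_space Y <> fullv].
  apply: contrapT => no; apply: nm; split=> // Y XY.
  case: (pselect (sub_space Y = X)) => [|YX]; first by left.
  by right; apply: contrapT => Yf; apply: no; exists Y.
have [|W mW YW] := IH Y Yf; last by exists W => //; apply: subv_trans YW.
have : (\dim X < \dim Y)%N.
  by rewrite (ltn_leqif (dimv_leqif_eq XY)); apply/eqP => e; apply: YX.
have := dimvS (subvf Y); move: dX.
set a := \dim {:M}; set b := \dim X; set c := \dim Y; lia.
Qed.

Lemma xget_least (P : submodule M -> Prop) (x : submodule M) U : least P U ->
  xget x (least P) = U.
Proof.
move=> [PU lU]; case: xgetP => [W _ [PW lW]|/(_ U)[]//].
by apply: submodule_eq; apply: subv_anti; rewrite lU // lW.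
Qed.

Lemma xget_greatest (P : submodule M -> Prop) (x : submodule M) U : greatest P U ->
  xget x (greatest P) = U.
Proof.
move=> [PU lU]; case: xgetP => [W _ [PW lW]|/(_ U)[]//].
by apply: submodule_eq; apply: subv_anti; rewrite lU // lW.
Qed.

Lemma soc_sub (W : submodule M) : simple (submod W) -> (W <= soc M)%VS.
Proof.
move=> sW; rewrite /soc; case: xgetP => [U _ [/(_ W sW)]//|no].
set P := (X in least X) in no; case: (@least_exists P) => [X _|X Y PX PY Z sZ|U lU].
- exact: subvf.
- by rewrite subv_cap PX ?PY.
- by case: (no U).
Qed.

Lemma rad_sub (W : submodule M) : maximal W -> (Defs.rad M <= W)%VS.
Proof.
move=> sW; rewrite /Defs.rad; case: xgetP => [U _ [/(_ W sW)]//|no].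
set P := (X in greatest X) in no; case: (@greatest_exists P) => [X _|X Y PX PY Z sZ|U lU].
- exact: sub0v.
- by rewrite subv_add PX ?PY.
- by case: (no U).
Qed.

Lemma big_subD I (r : seq I) (P : pred I) (F : I -> submodule M) :
  sub_space (\big[@subD K A M/sub0 M]_(i <- r | P i) F i) = (\sum_(i <- r | P i) F i)%VS.
Proof. exact: (big_morph (@sub_space K A M)). Qed.

Lemma big_subI I (r : seq I) (P : pred I) (F : I -> submodule M) :
  sub_space (\big[@subI K A M/subT M]_(i <- r | P i) F i) = (\bigcap_(i <- r | P i) F i)%VS.
Proof. exact: (big_morph (@sub_space K A M)). Qed.

Lemma functional_neq0 (w : M) : w != 0 -> exists f : 'Hom(M, K^o), f w != 0.
Proof.
move=> w0; apply: contrapT => no; case/eqP: w0.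
rewrite (coord_vbasis (memvf w)) big1 // => i _.
pose f : 'Hom(M, K^o) := linfun (coord (vbasis {:M}) i : M -> K^o).
suff /eqP : f w == 0 by rewrite lfunE /= => ->; rewrite scale0r.
by apply: contra_notT no => fw; exists f.
Qed.

Lemma iso_himg (N : module A) (f : modhom M N) (U : submodule M) (W : submodule N) :
  embedding f -> (f @: U)%VS = sub_space W -> iso (submod U) (submod W).
Proof.
move=> ef fU; apply/iso_submodP; exists (subf W \o f)%VF.
have fW u : u \in (U : {vspace M}) -> f u \in (W : {vspace N}) by move=> Uu; rewrite -fU memv_img.
split=> [a u Uu||].
- by rewrite !comp_lfunE hom_act subf_act ?fW.
- by rewrite limg_comp fU; case: (presents_sub W).
apply/vspaceP => u; rewrite memv_cap memv_ker comp_lfunE memv0; apply/andP/eqP => [[Uu /eqP s0]|->].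
  apply/eqP; rewrite -memv0 -ef memv_ker -(subfK (fW u Uu)) s0; exact/eqP/linear0.
by rewrite mem0v !linear0 eqxx.
Qed.

End Extremal.

Lemma iso_subT (K : fieldType) (A : falgType K) (M : module A) : iso (submod (subT M)) M.
Proof. by apply/iso_submodP; exists \1%VF; apply: presents_id. Qed.

(** * Annihilators of subspaces in the dual space *)

Section Annihilator.
Variables (K : fieldType) (X : vectType K).

Definition restr (B : {vspace X}) (g : 'Hom(X, K^o)) : 'Hom(subvs_of B, K^o) :=
  (g \o linfun vsval)%VF.

Lemma restr_linear B : linear (restr B).
Proof. by move=> c f g; rewrite /restr comp_lfunDl comp_lfunZl. Qed.
HB.instance Definition _ B := GRing.isLinear.Build K 'Hom(X, K^o) 'Hom(subvs_of B, K^o) _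
  (restr B) (restr_linear B).

Definition ann (B : {vspace X}) : {vspace 'Hom(X, K^o)} := lker (linfun (restr B)).

Lemma mem_annP (B : {vspace X}) (g : 'Hom(X, K^o)) : reflect (forall b, b \in B -> g b = 0) (g \in ann B).
Proof.
rewrite memv_ker lfunE /=; apply: (iffP eqP) => [g0 b Bb|g0]; last first.
  by apply/lfunP => b; rewrite comp_lfunE zero_lfunE lfunE g0 ?subvsP.
by have /lfunP/(_ (vsproj B b)) := g0; rewrite comp_lfunE zero_lfunE lfunE /= vsprojK.
Qed.

Lemma dim_ann (B : {vspace X}) : (\dim (ann B) + \dim B = \dim {:X})%N.
Proof.
have := limg_ker_dim (linfun (restr B)) fullv; rewrite capfv.
have -> : limg (linfun (restr B)) = fullv.
  apply: eq_fullv; apply/subvP => h _; apply/memv_imgP.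
  (* A functional on B is extended to X through the projection onto B. *)
  exists (h \o linfun (vsproj B))%VF; rewrite ?memvf // lfunE.
  by apply/lfunP => b; rewrite !comp_lfunE !lfunE /= vsvalK.
by rewrite !dimvf /dim /= !muln1.
Qed.

End Annihilator.

(** * Traces and rejects at sets of vertices; the modules P(i) and I(i) *)

Section VertexModules.
Variables (K : fieldType) (d : Order.disp_t) (V : finPOrderType d) (Q : quiver V).
Variables (A : falgType K) (phi : {rmorphism path_algebra Q K -> A}).
Hypothesis hA : bound_quiver_algebra phi.
Local Notation e := (vid phi).
Local Notation P := (Pmod phi).
Local Notation I := (Imod phi).
Local Notation chi := (chi hA).

Let ee i : e i * e i = e i := idemee phi i.

Definition trv (M : module A) (G : {set V}) (U : {vspace M}) : submodule M :=
  \big[@subD K A M/sub0 M]_(i in G) tr (e i) U.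

Lemma trvE (M : module A) G (U : {vspace M}) : sub_space (trv G U) = (\sum_(i in G) tr (e i) U)%VS.
Proof. exact: big_subD. Qed.

Lemma trv_set0 (M : module A) (U : {vspace M}) : trv finset.set0 U = sub0 M.
Proof. exact: big_set0. Qed.

Lemma trv_subP (M : module A) (G : {set V}) (U W : {vspace M}) :
  reflect (forall i, i \in G -> (tr (e i) U <= W)%VS) (trv G U <= W)%VS.
Proof. by rewrite trvE; apply: subv_sumP. Qed.

Lemma tr_trv (M : module A) (G : {set V}) (U : {vspace M}) i : i \in G -> (tr (e i) U <= trv G U)%VS.
Proof. by move=> iG; rewrite trvE; apply: (sumv_sup i). Qed.

Lemma trvS (M : module A) (G : {set V}) (U W : {vspace M}) : (U <= W)%VS -> (trv G U <= trv G W)%VS.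
Proof.
by move=> s; apply/trv_subP => i iG; apply: subv_trans (trS _ s) (tr_trv _ iG).
Qed.

Definition rejv (M : module A) (G : {set V}) : submodule M :=
  \big[@subI K A M/subT M]_(i in G) rejs M (e i).

Lemma rejvE (M : module A) G : sub_space (rejv M G) = (\bigcap_(i in G) rej M (e i))%VS.
Proof. exact: big_subI. Qed.

Lemma rejv_set0 (M : module A) : rejv M finset.set0 = subT M.
Proof. exact: big_set0. Qed.

Lemma rejvP (M : module A) (G : {set V}) (v : M) : reflect (forall i, i \in G -> forall a, act (e i * a) v = 0)
  (v \in (rejv M G : {vspace M})).
Proof.
rewrite rejvE memvE; apply: (iffP subv_bigcapP) => s i iG; first by move=> a; apply/rejP/s.
by rewrite -memvE; apply/rejP/s.
Qed.

Lemma rejvS (M : module A) (G G' : {set V}) : G \subset G' -> (rejv M G' <= rejv M G)%VS.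
Proof.
by move=> /fintype.subsetP s; apply/subvP => v /rejvP r; apply/rejvP => i /s; apply: r.
Qed.

(** Equal dimensions give e_k W inside U for every k, and each v is the sum of its components e_k
    v. *)
Lemma eq_cdim (M : module A) (U W : submodule M) : (U <= W)%VS ->
  (forall k, (cdim (e k) W <= cdim (e k) U)%N) -> sub_space U = W.
Proof.
move=> UW dW; apply: subv_anti; rewrite UW; apply/subvP => v Wv.
rewrite -(act1 v) -(sum_idem phi) act_suml; apply: memv_suml => i _.
apply: (subvP (eimg_eq (ee i) (@stableP _ _ _ U) UW (dW i))).
by rewrite -actfE memv_img.
Qed.

Lemma cdim_eq0 (M : module A) (U : {vspace M}) k v : cdim (e k) U = 0%N -> v \in U -> act (e k) v = 0.
Proof.
move/eqP; rewrite dimv_eq0 => /eqP E Uv; apply/eqP; rewrite -memv0 -E -actfE.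
exact: memv_img.
Qed.

Definition genP i : P i := vsproj (Aidem phi i) (e i).

Lemma val_genP i : vsval (genP i) = e i.
Proof. by rewrite /genP vsprojK // mem_Aidem ee. Qed.

Lemma val_act i a (y : P i) : vsval (act a y) = a * vsval y.
Proof. exact: (submod_actE (U := Aidem phi i)). Qed.

Lemma PE i (y : P i) : y = act (vsval y) (genP i).
Proof.
apply: subvs_inj; rewrite val_act val_genP.
by have := subvsP y; rewrite mem_Aidem => /eqP.
Qed.

Lemma act_genP i : act (e i) (genP i) = genP i.
Proof. by apply: subvs_inj; rewrite val_act val_genP ee. Qed.

Lemma Phom_ex (M : module A) i (v : M) : act (e i) v = v -> exists f : modhom (P i) M, f (genP i) = v.
Proof.
move=> ev; pose f : 'Hom(P i, M) := (actv v \o linfun vsval)%VF.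
have fE u : f u = act (vsval u) v by rewrite comp_lfunE actvE lfunE.
have fa a u : f (act a u) = act a (f u) by rewrite !fE val_act actM.
by exists (Defs.Hom fa); rewrite /= fE val_genP.
Qed.

(** The surjection P(i) ->> S(i), written as a linear form. *)
Lemma Pmod_functional i : exists p : 'Hom(P i, K^o),
  p (genP i) != 0 /\ forall a y, p (act a y) = chi i a * p y.
Proof.
pose p : 'Hom(P i, K^o) := (chif hA i \o linfun vsval)%VF.
have pE y : p y = chi i (vsval y) by rewrite comp_lfunE !lfunE.
exists p; split=> [|a y]; rewrite !pE.
  by rewrite val_genP (chi_idem hA) eqxx oner_eq0.
by rewrite val_act chiM.
Qed.

Lemma ImodE (i : V) a (y : I i) (x : subvs_of (right_ideal (idem phi i))) :
  (act a y : 'Hom(_, _)) x = (y : 'Hom(_, _)) (rmul (idem phi i) a x).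
Proof. exact: comp_lfunE. Qed.

Lemma mem_right_ideal i (a : A) : (a \in right_ideal (idem phi i)) = (e i * a == a).
Proof.
rewrite vidE; apply/idP/eqP => [|<-]; last by rewrite memv_mul ?memvf ?memv_line.
have s : (right_ideal (e i) <= fixedSpace (amull (e i)))%VS.
  apply/prodvP => _ b /vlineP[c ->] _; apply/fixedSpaceP.
  by rewrite lfunE /= mulrA -scalerAr ee.
by move=> /(subvP s) /fixedSpaceP; rewrite lfunE.
Qed.

(** The reject of e_i in I(i) is zero: a functional y on e_i A has y(x) = (x y)(e_i), and x = e_i x.
    This is the form in which the simple socle of I(i) is used. *)
Lemma Imod_soc i (y : I i) : (forall a, act (e i * a) y = 0) -> y = 0.
Proof.
move=> y0; apply/lfunP => x; have ei : e i \in right_ideal (idem phi i) by rewrite mem_right_ideal ee.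
have /lfunP/(_ (vsproj _ (e i))) := y0 (vsval x); rewrite ImodE !zero_lfunE => <-.
congr (fun_of_lfun y _); apply: subvs_inj; rewrite rmulE vsprojK // mulrA ee.
by have := subvsP x; rewrite mem_right_ideal => /eqP.
Qed.

(** Homomorphisms M -> I(i) correspond to linear forms on e_i M: v goes to the functional x -> l(x
    v) on e_i A. Only the kernel is needed later. *)
Lemma Ihom_ex (M : module A) i (l : 'Hom(M, K^o)) : exists f : modhom M (I i),
  forall v, f v = 0 <-> forall a, l (act (e i * a) v) = 0.
Proof.
pose h (v : M) : I i := (l \o actv v \o linfun vsval)%VF.
have hE v x : h v x = l (act (vsval x) v) by rewrite /h !comp_lfunE actvE lfunE.
have hl : linear h.
  move=> c v w; apply/lfunP => x; rewrite hE add_lfunE scale_lfunE !hE.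
  by rewrite actDr linearP.
pose f : 'Hom(M, I i) := linfun (HB.pack_for {linear M -> I i} h
  (GRing.isLinear.Build K M (I i) _ _ hl)).
have fE v : f v = h v by rewrite lfunE.
have fa a v : f (act a v) = act a (f v).
  by rewrite !fE; apply/lfunP => x; rewrite ImodE !hE rmulE actM.
exists (Defs.Hom fa) => v /=; rewrite fE; split=> [h0 a|h0].
  have aE : e i * a \in right_ideal (idem phi i) by rewrite mem_right_ideal mulrA ee.
  by have /lfunP/(_ (vsproj _ (e i * a))) := h0; rewrite hE vsprojK // zero_lfunE.
apply/lfunP => x; rewrite hE zero_lfunE.
by have := subvsP x; rewrite mem_right_ideal => /eqP <-.
Qed.

(** The space e_k I(j) is the dual of e_j A e_k = e_j P(k). Inside it, lying in the reject of G
    means vanishing on every e_j A e_i A e_k with i in G, that is, on e_j tr_G P(k). The identity is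
    the dimension formula for this annihilator. *)
Lemma cdim_rejv_Imod (G : {set V}) j k :
  (cdim (e k) (rejv (I j) G) + cdim (e j) (trv G (fullv : {vspace P k}))
    = cdim (e j) (fullv : {vspace P k}))%N.
Proof.
set T := trv _ _.
pose X := subvs_of (right_ideal (idem phi j)).
(* Left multiplication by e_j from A e_k to e_j A, and back by right multiplication by e_k. Their
   composites are the actions of e_k and e_j, so both restrict to the identity on e_j A e_k. *)
pose m : 'Hom(P k, X) := (linfun (vsproj (right_ideal (idem phi j))) \o amull (e j) \o linfun vsval)%VF.
pose m' : 'Hom(X, P k) := (linfun (vsproj (Aidem phi k)) \o amulr (e k) \o linfun vsval)%VF.
have mE y : vsval (m y) = e j * vsval y.
  by rewrite !comp_lfunE !lfunE /= vsprojK // mem_right_ideal mulrA ee.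
have mE' x : vsval (m' x) = vsval x * e k.
  by rewrite !comp_lfunE !lfunE /= vsprojK // mem_Aidem_mul.
clearbody m m'.
have valP (x : X) : e j * vsval x = vsval x.
  by have := subvsP x; rewrite mem_right_ideal => /eqP.
have valP' (y : P k) : vsval y * e k = vsval y.
  by have := subvsP y; rewrite mem_Aidem => /eqP.
have mm' x : m (m' x) = rmul (idem phi j) (e k) x.
  by apply: subvs_inj; rewrite mE mE' rmulE mulrA valP.
have m'm y : m' (m y) = act (e j) y.
  by apply: subvs_inj; rewrite mE' mE val_act -mulrA valP'.
pose t (f : I j) : 'Hom(P k, K^o) := (f \o m)%VF.
have tl : linear t by move=> c f g; rewrite /t comp_lfunDl comp_lfunZl.
pose th : 'Hom(I j, 'Hom(P k, K^o)) := linfun (HB.pack_for {linear I j -> 'Hom(P k, K^o)} t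
  (GRing.isLinear.Build K (I j) 'Hom(P k, K^o) _ _ tl)).
have thE f y : th f y = (f : 'Hom(X, K^o)) (m y) by rewrite lfunE comp_lfunE.
have eR f : (f \in (actf (I j) (e k) @: rejv (I j) G)%VS) =
    (f \in (rejv (I j) G : {vspace I j})) && (act (e k) f == f).
  by apply: memv_eimg; [exact: ee | exact: stableP].
have inj : (actf (I j) (e k) @: rejv (I j) G :&: lker th = 0)%VS.
  apply/eqP; rewrite -subv0; apply/subvP => f; rewrite memv_cap memv_ker memv0 eR.
  case/andP=> /andP[_ /eqP ef] /eqP t0; rewrite -ef; apply/eqP/lfunP => x.
  by rewrite ImodE -mm' -thE t0 !zero_lfunE.
(* Functionals on e_j P(k) are encoded as functionals on P(k) that vanish on the kernel of e_j,
   which is why that kernel is added to [T]. *)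
have img : (th @: (actf (I j) (e k) @: rejv (I j) G) = ann (lker (actf (P k) (e j)) + T))%VS.
  apply/vspaceP => g; apply/memv_imgP/mem_annP => [[f + ->] _ /memv_addP[y + [z zT ->]]|g0].
    rewrite eR memv_ker actfE => /andP[/rejvP fR /eqP ef] /eqP y0.
    rewrite thE linearD /= linearD /=.
    have -> : m y = 0 by apply: subvs_inj; rewrite mE -val_act y0 !linear0.
    rewrite linear0 add0r -thE; apply/eqP; rewrite -memv_ker.
    apply: subvP zT; apply/trv_subP => i iG; apply/(@tr_subP _ _ _ _ (subT _)) => a u _.
    rewrite memv_ker thE; have ui := congr1 (fun h : I j => (h : 'Hom(_,_)) (vsproj (right_ideal (idem phi j)) (e j * a)))
      (fR i iG (vsval u)).
    move: ui; rewrite ImodE zero_lfunE => /eqP; congr (fun_of_lfun f _ == 0).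
    apply: subvs_inj; rewrite rmulE mE vsprojK ?mem_right_ideal ?mulrA ?ee //.
    by rewrite val_act !mulrA.
  have ge y : g (act (e j) y) = g y.
    apply/eqP; rewrite -subr_eq0 -linearB /= g0 //; rewrite -[X in X \in _]addr0 memv_add ?mem0v //.
    by rewrite memv_ker actfE actBr -actM ee subrr.
  exists (g \o m' : I j)%VF; last by apply/lfunP => y; rewrite thE comp_lfunE m'm ge.
  rewrite eR; apply/andP; split; last first.
    apply/eqP/lfunP => x; rewrite ImodE !comp_lfunE; congr (fun_of_lfun g _).
    by apply: subvs_inj; rewrite !mE' rmulE -mulrA ee.
  apply/rejvP => i iG a; apply/lfunP => x; rewrite ImodE comp_lfunE zero_lfunE g0 //.
  rewrite -[X in X \in _]add0r memv_add ?mem0v //.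
  apply: (subvP (tr_trv _ iG)).
  suff -> : m' (rmul (idem phi j) (e i * a) x) = act (vsval x * e i) (act a (genP k)).
    by rewrite mem_tr ?memvf.
  apply: subvs_inj; rewrite mE' rmulE !val_act val_genP.
  by rewrite !mulrA.
rewrite {1}/cdim -(limg_dim_eq inj) img.
have dL := limg_ker_dim (actf (P k) (e j)) (lker (actf (P k) (e j)) + T).
have dF := limg_ker_dim (actf (P k) (e j)) fullv.
have dA := dim_ann (lker (actf (P k) (e j)) + T).
rewrite capfv in dF; rewrite (capv_idPr (addvSl _ _)) limgD in dL.
have k0 : (actf (P k) (e j) @: lker (actf (P k) (e j)) = 0)%VS by apply/eqP; rewrite -lkerE.
rewrite k0 add0v in dL; rewrite /cdim.
move: dL dF dA; set a1 := \dim _; set a2 := \dim _; set a3 := \dim _; set a4 := \dim _.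
set a5 := \dim _; set a6 := \dim _; lia.
Qed.

End VertexModules.

(** * Counting in upsets of a finite poset *)

Section Upsets.
Variables (d : Order.disp_t) (V : finPOrderType d).
Implicit Types (B : {set V}) (i j k : V).

(** The system is unitriangular for the order, so the c k are recovered from the top downwards, by
    induction on the number of elements strictly above k. *)
Lemma upper_sum_inj (c c' : V -> nat) :
  (forall k, \sum_i (k <= i)%O * c i = \sum_i (k <= i)%O * c' i)%N -> c =1 c'.
Proof.
move=> E k; move: {2}(#|[set l | (k < l)%O]|)%SET (leqnn #|[set l | (k < l)%O]%SET|) => n.
elim: n k => [|n IH] k kn; have := E k; rewrite (bigD1 k) //= [RHS](bigD1 k) //= lexx !mul1n.
  rewrite !big1 ?addn0 // => i ik; rewrite (_ : (k <= i)%O = false) //;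
    by move: kn; rewrite leqn0 cards_eq0 => /eqP/setP/(_ i); rewrite !inE lt_neqAle eq_sym ik.
rewrite (eq_bigr (fun i => (k <= i)%O * c' i)%N); first by move/addIn.
move=> i ik; case: (boolP (k <= i)%O) => // ki; congr (_ * _)%N; apply: IH.
rewrite -ltnS (leq_trans _ kn) //; apply: proper_card; apply/properP; split.
  by apply/fintype.subsetP => l; rewrite !inE; apply: le_lt_trans.
by exists i; rewrite !inE ?ltxx // lt_neqAle eq_sym ik.
Qed.

Lemma sum_nat_card (p : pred V) : (\sum_i p i = #|[set i | p i]%SET|)%N.
Proof. by rewrite -sum1_card [RHS]big_mkcond /=; apply: eq_bigr => i _; rewrite inE; case: (p i). Qed.

Lemma card_LambdaI (i j : V) : (j <= i)%O -> Lambda i :&: Lambda j = Lambda i.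
Proof.
move=> ji; apply/finset.setP => l; rewrite !inE; case: (boolP (i <= l)%O) => //= il.
exact: le_trans il.
Qed.

Definition upset (G : {set V}) := forall x y, x \in G -> (x <= y)%O -> y \in G.

Lemma upset_Lambda j : upset (Lambda j).
Proof. by move=> x y; rewrite !inE; apply: le_trans. Qed.

Definition minimal_in i (B : {set V}) :=
  i \in B /\ forall l, l \in B -> (l <= i)%O -> l = i.

Lemma minimal_exists (B : {set V}) x : x \in B -> exists i, minimal_in i B.
Proof.
move=> xB.
(* An element of B with the fewest elements of B below it is minimal in B. *)
case: (@arg_minnP _ x (mem B) (fun y => #|[set l in B | (l <= y)%O]%SET|) xB) => y yB ymin.
have {}yB : y \in B := yB; exists y; split=> // l lB ly.
apply/eqP; apply: contraT => nly; have := ymin l lB; rewrite leqNgt => /negP[].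
apply: proper_card; apply/properP; split.
  by apply/fintype.subsetP => z; rewrite !inE => /andP[-> zl]; apply: le_trans ly.
exists y; first by rewrite !inE yB lexx.
by rewrite !inE yB /=; apply: contra nly => yl; apply/eqP/le_anti; rewrite ly.
Qed.

Lemma upset_D1 B i : upset B -> minimal_in i B -> upset (B :\ i).
Proof.
move=> uB [_ imin] x y; rewrite !inE => /andP[xi xB] xy; rewrite (uB _ _ xB xy) andbT.
by apply: contra xi => /eqP yi; apply/eqP; apply: imin => //; rewrite -yi.
Qed.

Lemma card_upset_D1 B i k : i \in B ->
  #|B :&: Lambda k| = (#|(B :\ i) :&: Lambda k| + (k <= i)%O)%N.
Proof.
move=> iB; rewrite (cardsD1 i (B :&: Lambda k)) !inE iB addnC; congr (_ + _)%N.
by apply: eq_card => l; rewrite !inE andbA.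
Qed.

Lemma card_upset_C1 B i j k : i \in B -> B \subset Lambda j ->
  #|(Lambda j :&: Lambda k) :\: (B :\ i)| = (#|(Lambda j :&: Lambda k) :\: B| + (k <= i)%O)%N.
Proof.
move=> iB sB; have ji : (j <= i)%O by have := fintype.subsetP sB i iB; rewrite inE.
rewrite (cardsD1 i) !inE eqxx ji /= addnC; congr (_ + _)%N.
apply: eq_card => l; rewrite !inE negb_and negbK.
by have [->|] := eqVneq l i; rewrite ?iB.
Qed.

End Upsets.

(** * Tuples in L(j) as chains of upsets; a common argument for both filtrations *)

Section Chains.
Variables (d : Order.disp_t) (V : finPOrderType d) (j : V).
Local Notation r := #|Lambda j|.

(** With entries counted from 0, this is the set indexing D(t+1) and N(t+1). *)
Definition tailset (s : r.-tuple V) (t : nat) : {set V} :=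
  [set tnth s m | m in [pred m : 'I_r | (t <= m)%N]]%SET.

Lemma tailsetP s t x :
  reflect (exists2 m : 'I_r, (t <= m)%N & x = tnth s m) (x \in tailset s t).
Proof. by apply: (iffP imsetP) => -[m tm ->]; exists m. Qed.

Section Tuple.
Variable s : r.-tuple V.
Hypothesis sL : calL j s.

Lemma calL_inj : injective (tnth s).
Proof.
have [_ lt] := sL.
move=> k t kt; apply: val_inj; case: (ltngtP (k : nat) t) => // l.
  by have := lt k t l; rewrite kt lexx.
by have := lt t k l; rewrite kt lexx.
Qed.

Lemma tailset0 : tailset s 0 = Lambda j.
Proof.
apply/eqP; rewrite eqEcard; apply/andP; split.
  by apply/fintype.subsetP => _ /tailsetP[m _ ->]; have [] := sL.
rewrite card_imset; last exact: calL_inj.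
by rewrite (eq_card (B := 'I_r)) ?card_ord // => m; rewrite !inE.
Qed.

Lemma tailset_end : tailset s r = finset.set0.
Proof. by apply/finset.setP => x; rewrite inE; apply/tailsetP => -[m]; rewrite leqNgt ltn_ord. Qed.

Lemma tailset_sub t : tailset s t \subset Lambda j.
Proof. by rewrite -tailset0; apply/fintype.subsetP => _ /tailsetP[m _ ->]; apply/tailsetP; exists m. Qed.

(** The entries of s exhaust Λ(j), so anything above a tail entry occurs in s, and the defining
    condition of L(j) forbids it to occur earlier. *)
Lemma upset_tailset t : upset (tailset s t).
Proof.
move=> _ y /tailsetP[m tm ->] xy; have : y \in Lambda j.
  by apply: upset_Lambda xy; have [] := sL.
rewrite -tailset0 => /tailsetP[m' _ yE]; apply/tailsetP; exists m' => //.
rewrite leqNgt; apply/negP => m't; have [_ lt] := sL.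
by have := lt m' m (leq_trans m't tm); rewrite -yE xy.
Qed.

Lemma tailsetS (t : 'I_r) : tailset s t.+1 = tailset s t :\ tnth s t.
Proof.
apply/finset.setP => x; rewrite !inE; apply/tailsetP/andP => [[m tm ->]|[xt /tailsetP[m tm xm]]].
  split; last by apply/tailsetP; exists m => //; apply: ltnW.
  by apply: contraTneq tm => /calL_inj ->; rewrite ltnn.
exists m => //; rewrite ltn_neqAle tm andbT; apply: contraNneq xt => tm'.
by rewrite xm; apply/eqP; congr tnth; apply: val_inj.
Qed.

Lemma minimal_tailset (t : 'I_r) : minimal_in (tnth s t) (tailset s t).
Proof.
split; first by apply/tailsetP; exists t.
move=> _ /tailsetP[m tm ->] mt; congr tnth; apply/val_inj/eqP.
rewrite eqn_leq tm andbT leqNgt; apply/negP; have [_ lt] := sL.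
by move/lt; rewrite mt.
Qed.

End Tuple.

(** Here [G] stands for B -> tr_B P(j) or B -> rej_B I(j), and [step U W i] for a subquotient
    isomorphic to Delta(i) or nabla(i). [step_ex] makes the maps well defined, [step_label] gives
    injectivity, and [step_inv] with [G_inj0] gives surjectivity. *)
Variables (T : Type) (G : {set V} -> T) (step : T -> T -> V -> Prop).
Hypothesis step_ex : forall (B : {set V}) i, upset B -> B \subset Lambda j ->
  minimal_in i B -> step (G B) (G (B :\ i)) i.
Hypothesis step_label : forall U W i i', step U W i -> step U W i' -> i = i'.
Hypothesis step_inv : forall (B : {set V}) W i, upset B -> B \subset Lambda j ->
  step (G B) W i -> minimal_in i B /\ W = G (B :\ i).
Hypothesis G_inj0 : forall B : {set V}, upset B -> B \subset Lambda j -> G B = G finset.set0 -> B = finset.set0.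

Lemma calL_step s (t : 'I_r) : calL j s -> step (G (tailset s t)) (G (tailset s t.+1)) (tnth s t).
Proof.
move=> sL; rewrite tailsetS //; apply: step_ex.
- exact: upset_tailset.
- exact: tailset_sub.
- exact: minimal_tailset.
Qed.

Lemma calL_chain_inj s s' : calL j s -> calL j s' ->
  (forall t, (t <= r)%N -> G (tailset s t) = G (tailset s' t)) -> s = s'.
Proof.
move=> sL sL' E; apply: eq_from_tnth => t; apply: (step_label (calL_step t sL)).
by rewrite !E ?(ltnW (ltn_ord t)) //; apply: calL_step.
Qed.

(** Starting from Λ(j), [step_inv] forces each term to be [G] of the previous set minus a minimal
    element. The labels removed form the required tuple. *)
Lemma chain_calL (H : nat -> T) m : H 0%N = G (Lambda j) -> H m = G finset.set0 ->
  (forall t, (t < m)%N -> exists i, step (H t) (H t.+1) i) ->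
  m = r /\ exists2 s, calL j s & forall t, (t <= r)%N -> H t = G (tailset s t).
Proof.
move=> H0 Hm Hs; have /choice[lab labP] : forall t, exists i, (t < m)%N -> step (H t) (H t.+1) i.
  (* Past the end of the chain the label is a dummy, here j. *)
  by move=> t; case: (ltnP t m) => [/Hs[i]|_]; [exists i | exists j].
pose fix rest t := if t is t'.+1 then rest t' :\ lab t' else Lambda j.
have restP t : (t <= m)%N -> [/\ upset (rest t), rest t \subset Lambda j, H t = G (rest t) &
    (#|rest t| + t)%N = r].
  elim: t => [_|t IH tm]; first by split=> //=; [exact: upset_Lambda | rewrite addn0].
  have [u sub HE c] := IH (ltnW tm); have := labP t tm; rewrite HE.
  case/(step_inv u sub) => -[lr lm] ->; split=> //=.
  - move=> x y; rewrite !inE => /andP[xl xr] xy; rewrite (u _ _ xr xy) andbT.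
    by apply: contra xl => /eqP yl; apply/eqP/lm => //; rewrite -yl.
  - by apply: fintype.subset_trans sub; apply: subD1set.
  - by rewrite -c (cardsD1 (lab t) (rest t)) lr addnS.
have labm t : (t < m)%N -> minimal_in (lab t) (rest t).
  move=> tm; have [u sub HE _] := restP t (ltnW tm).
  by have := labP t tm; rewrite HE => /(step_inv u sub)[].
have mr : m = r.
  (* The length is not assumed: the last set is empty by [G_inj0], and every step removed exactly
     one element of Λ(j). *)
  have [u sub HE <-] := restP m (leqnn m); rewrite (G_inj0 u sub) ?cards0 //.
  by rewrite -HE.
split=> //; pose s := [tuple lab t | t < r].
have sE t : tnth s t = lab t by rewrite tnth_mktuple.
have restS a b : (a <= b)%N -> rest b \subset rest a.
  elim: b => [|b IH]; first by rewrite leqn0 => /eqP ->.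
  rewrite leq_eqVlt => /predU1P[->//|/IH]; apply: fintype.subset_trans; exact: subD1set.
have sL : calL j s.
  split=> [t|k t kt]; rewrite !sE.
    have tm : (t < m)%N by rewrite mr.
    have [_ sub _ _] := restP t (ltnW tm).
    by apply: (fintype.subsetP sub); have [] := labm t tm.
  have [|lk lmin] := labm k; first by rewrite mr.
  have [|lt _] := labm t; first by rewrite mr.
  (* For k < t the label of t is still present after that of k is removed, so it differs from it
     and, by minimality, does not lie below it. *)
  have := fintype.subsetP (restS _ _ kt) _ lt; rewrite /= !inE => /andP[ne tk].
  by apply: contra ne => /(lmin _ tk)/eqP.
exists s => // t tr; have [|_ _ -> _] := restP t; first by rewrite mr.
congr G; elim: t tr => [_|t IH tr]; first by rewrite tailset0.
by rewrite (tailsetS sL (Ordinal tr)) -IH ?(ltnW tr) // sE.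
Qed.

End Chains.

(** * Delta(i) and nabla(i) through traces and rejects *)

Section StandardModules.
Variables (K : fieldType) (d : Order.disp_t) (V : finPOrderType d) (Q : quiver V).
Variables (A : falgType K) (phi : {rmorphism path_algebra Q K -> A}).
Hypothesis hA : bound_quiver_algebra phi.
Local Notation e := (vid phi).
Local Notation P := (Pmod phi).
Local Notation I := (Imod phi).
Local Notation Delta := (Delta phi).
Local Notation Nabla := (Nabla phi).
Local Notation chi := (chi hA).
Local Notation trv := (trv phi).
Local Notation rejv := (rejv phi).
Local Notation full M := (fullv : {vspace (carrier M)}).

Let ee i : e i * e i = e i := idemee phi i.

Definition noncomp_le (i : V) : {set V} := [set k | ~~ (k <= i)%O]%SET.

Lemma bounded_factorsP i (M : module A) :
  bounded_factors phi i M <-> forall k, ~~ (k <= i)%O -> cdim (e k) (full M) = 0%N.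
Proof. by split=> b k /b; rewrite (JH_multE hA). Qed.

(** A quotient of P(i) has no factor S(k) exactly when e_k kills it, so the smallest admissible
    kernel is generated by all e_k P(i) with k not below i. *)
Definition DeltaU i : submodule (P i) := trv (noncomp_le i) fullv.

Lemma DeltaU_least i :
  least (fun U : submodule (P i) => bounded_factors phi i (quotmod U)) (DeltaU i).
Proof.
split=> [|W /bounded_factorsP bW].
  apply/bounded_factorsP => k ki; apply/eqP; rewrite dimv_eq0 -subv0.
  apply/subvP => _ /memv_imgP[w _ ->]; have [v ->] := quotf_surj w.
  rewrite actfE -quotf_act memv0 quotf_eq0.
  have kG : k \in noncomp_le i by rewrite inE.
  apply: (subvP (tr_trv _ _ kG)).
  by have := mem_tr (e k) 1 (memvf v); rewrite mul1r.
apply/trv_subP => k; rewrite inE => ki.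
apply: (@tr_eimg_sub _ _ _ (e k) (subT _)); first exact: stableP.
apply/subvP => _ /memv_imgP[v _ ->]; rewrite actfE -quotf_eq0 quotf_act.
by rewrite (cdim_eq0 (bW k ki)) ?memvf.
Qed.

Lemma DeltaE i : Delta i = quotmod (DeltaU i).
Proof. by rewrite /Defs.Delta (xget_least _ (DeltaU_least i)). Qed.

Lemma Delta_gen i : exists2 x : Delta i, act (e i) x = x & forall y, exists a, y = act a x.
Proof.
rewrite DeltaE; exists (quotf (DeltaU i) (genP phi i)) => [|w].
  by rewrite -quotf_act act_genP.
have [v ->] := quotf_surj w; exists (vsval v).
by rewrite -quotf_act -PE.
Qed.

(** The map from Delta(i) onto its top S(i), used to detect which generators of a trace survive in a
    quotient Delta(i). *)
Lemma Delta_functional i : exists t : 'Hom(Delta i, K^o),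
  t != 0 /\ forall a y, t (act a y) = chi i a * t y.
Proof.
rewrite DeltaE; have [p [p0 pa]] := Pmod_functional hA i.
have pU v : v \in (DeltaU i : {vspace P i}) -> p v = 0.
  move=> vU; apply/eqP; rewrite -memv_ker; apply: subvP vU; apply/trv_subP => k.
  rewrite inE => ki; apply/(@tr_subP _ _ _ _ (subT _)) => a u _.
  rewrite memv_ker pa (chiM hA) (chi_idem hA) (_ : k == i = false) ?mulr0 ?mul0r //.
  by apply: contraNF ki => /eqP ->.
(* Here [q] chooses representatives; [p] kills [DeltaU i], so the composite is the induced form on
   the quotient. *)
pose q : 'Hom(quotmod (DeltaU i), P i) := linfun vsval.
pose t : 'Hom(quotmod (DeltaU i), K^o) := (p \o q)%VF.
have tE v : t (quotf (DeltaU i) v) = p v.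
  rewrite comp_lfunE quotfE /q lfunE /=; apply/eqP; rewrite eq_sym -subr_eq0 -linearB.
  by apply/eqP/pU/quot_decomp.
exists t; split=> [|a w].
  apply: contraNneq p0 => t0.
  by rewrite -tE t0 zero_lfunE.
by have [v ->] := quotf_surj w; rewrite -quotf_act !tE pa.
Qed.

Definition NablaU i : submodule (I i) := rejv (I i) (noncomp_le i).

Lemma NablaU_greatest i :
  greatest (fun U : submodule (I i) => bounded_factors phi i (submod U)) (NablaU i).
Proof.
split=> [|W /bounded_factorsP bW].
  apply/bounded_factorsP => k ki; rewrite cdim_submod //; apply/eqP; rewrite dimv_eq0 -subv0.
  apply/subvP => _ /memv_imgP[w wU ->]; rewrite actfE memv0.
  have kG : k \in noncomp_le i by rewrite inE.
  by have := rejvP _ _ _ wU k kG 1; rewrite mulr1 => ->.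
apply/subvP => w Ww; apply/rejvP => k; rewrite inE => ki a; rewrite actM.
have := bW k ki; rewrite cdim_submod // => W0.
by apply: cdim_eq0 W0 _; apply: stable_sub.
Qed.

Lemma NablaE i : Nabla i = submod (NablaU i).
Proof. by rewrite /Defs.Nabla (xget_greatest _ (NablaU_greatest i)). Qed.

End StandardModules.

Lemma modhom_comp (K : fieldType) (A : falgType K) (M N N' : module A)
    (g : modhom N N') (f : modhom M N) : exists h : modhom M N', forall v, h v = g (f v).
Proof.
have gfa a v : (g \o f)%VF (act a v) = act a ((g \o f)%VF v) by rewrite !comp_lfunE !hom_act.
by exists (Defs.Hom gfa) => v; rewrite /= comp_lfunE.
Qed.

Lemma embedding_inj (K : fieldType) (A : falgType K) (M N : module A) (f : modhom M N) :
  embedding f <-> injective f.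
Proof. by split=> [/eqP/lker0P//|/lker0P/eqP]. Qed.

(** * Dimension vectors and Delta-filtrations of P(j) *)

Section OneQuasiHereditary.
Variables (K : fieldType) (d : Order.disp_t) (V : finPOrderType d) (Q : quiver V).
Variables (A : falgType K) (phi : {rmorphism path_algebra Q K -> A}).
Hypothesis hA : bound_quiver_algebra phi.
Variables one top : V.
Hypothesis hq : one_quasi_hereditary phi one top.
Local Notation e := (vid phi).
Local Notation P := (Pmod phi).
Local Notation I := (Imod phi).
Local Notation Delta := (Delta phi).
Local Notation Nabla := (Nabla phi).
Local Notation chi := (chi hA).
Local Notation trv := (trv phi).
Local Notation rejv := (rejv phi).
Local Notation full M := (fullv : {vspace (carrier M)}).

Let ee i : e i * e i = e i := idemee phi i.

Lemma one_le i : (one <= i)%O.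
Proof. by have [_ /(_ i)/andP[]] := hq. Qed.

Lemma cdim_Delta i k : cdim (e k) (full (Delta i)) = (k <= i)%O.
Proof.
case: (boolP (k <= i)%O) => ki.
  by have [_ _ /(_ i k ki)[+ _] _ _] := hq; rewrite (JH_multE hA).
have [+ _] := DeltaU_least hA i; rewrite -DeltaE // => /(bounded_factorsP hA).
by move/(_ k ki).
Qed.

(** The generator gives a surjection P(i) ->> N. Its kernel contains [DeltaU i], as N has no factor
    outside the elements below i, and equal dimension vectors make the two coincide. *)
Lemma Delta_criterion (N : module A) i (v : N) : act (e i) v = v ->
  (forall y, exists a, y = act a v) -> (forall k, cdim (e k) (full N) = (k <= i)%O) ->
  iso N (Delta i).
Proof.
move=> ev gv dN; have [f fv] := Phom_ex ev.
have sf : surjection f.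
  apply: eq_fullv; apply/subvP => y _; have [a ->] := gv y.
  by rewrite -fv -hom_act memv_img ?memvf.
have fP : presents (fullv : {vspace P i}) (hker f) f by apply: presents_modhom.
have iN : iso (quotmod (hker f)) N by apply/iso_quotmodP; exists f.
have dP k := cdim_presents (ee k) (U := subT (P i)) (W := hker f) fP.
rewrite DeltaE //; suff -> : DeltaU phi i = hker f by apply: iso_sym.
have dU k := cdim_quotmod (ee k) (DeltaU phi i).
apply: submodule_eq; apply: (eq_cdim (phi := phi)).
  have [_ l] := DeltaU_least hA i; apply: l; apply/(bounded_factorsP hA) => k ki.
  by rewrite (cdim_iso (ee k) iN) dN (negPf ki).
move=> k; have := esym (dP k); rewrite [X in _ = X](dU k) dN -DeltaE // cdim_Delta.
by move/addIn ->.
Qed.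

Lemma Delta_inj i i' : iso (Delta i) (Delta i') -> i = i'.
Proof.
move=> ii; have E k : (k <= i)%O = (k <= i')%O.
  have := etrans (esym (cdim_Delta i k)) (etrans (cdim_iso (ee k) ii) (cdim_Delta i' k)).
  by case: (k <= i)%O; case: (k <= i')%O.
by apply: le_anti; rewrite -E lexx E lexx.
Qed.

Section DeltaFiltration.
Variables (M : module A) (F : seq (submodule M)).
Hypothesis FD : filtration (fun N => exists k, iso N (Delta k)) F.
Local Notation sq t := (subquot (nth (sub0 M) F t.+1) (nth (sub0 M) F t)).

Lemma Delta_labels : exists lab : nat -> V,
  forall t, (t < (size F).-1)%N -> iso (sq t) (Delta (lab t)).
Proof.
suff /choice[lab labP] : forall t, exists k, (t < (size F).-1)%N -> iso (sq t) (Delta k).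
  by exists lab.
move=> t; case: (boolP (t < (size F).-1)%N) => tF; last by exists one.
by have [_ _ _ /(_ t)] := FD; rewrite -ltn_predRL => /(_ tF)[_ [k ik]]; exists k.
Qed.

Lemma factor_count_label lab i : (forall t, (t < (size F).-1)%N -> iso (sq t) (Delta (lab t))) ->
  factor_count F (Delta i) = (\sum_(t < (size F).-1) (lab t == i))%N.
Proof.
move=> labP; apply: eq_bigr => t _; congr nat_of_bool.
apply/asboolP/eqP => [ti|<-]; last exact: labP.
by apply: Delta_inj; apply: iso_trans ti; apply: iso_sym; apply: labP.
Qed.

Lemma sum_label lab (w : V -> nat) :
  (forall t, (t < (size F).-1)%N -> iso (sq t) (Delta (lab t))) ->
  (\sum_(t < (size F).-1) w (lab t) = \sum_i w i * factor_count F (Delta i))%N.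
Proof.
move=> labP; under [RHS]eq_bigr => i _ do rewrite (factor_count_label i labP) big_distrr /=.
rewrite exchange_big /=; apply: eq_bigr => t _.
rewrite (bigD1 (lab t)) //= eqxx muln1 big1 ?addn0 // => i /negPf.
by rewrite eq_sym => ->; rewrite muln0.
Qed.

Lemma cdim_Delta_filtration k :
  cdim (e k) (full M) = (\sum_i (k <= i)%O * factor_count F (Delta i))%N.
Proof.
have [lab labP] := Delta_labels; rewrite (filtration_cdim (ee k) FD) -(sum_label _ labP).
by apply: eq_bigr => t _; rewrite (cdim_iso (ee k) (labP t _)) ?cdim_Delta.
Qed.

(** Induction along the filtration. A factor Delta(l) with l in G is generated by its e_l part,
    hence is covered by the trace; any other factor costs at most dim e_k Delta(l). *)
Lemma cdim_trv_filtration lab (G : {set V}) k t :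
  (forall t, (t < (size F).-1)%N -> iso (sq t) (Delta (lab t))) -> (t <= (size F).-1)%N ->
  (cdim (e k) (nth (sub0 M) F t) <= cdim (e k) (trv G (nth (sub0 M) F t)) +
     \sum_(s < t) ((lab s \notin G) && (k <= lab s)%O))%N.
Proof.
move=> labP; have [F0 Fs Fe FF] := FD.
elim: t => [_|t IH tF]; first by rewrite Fs cdim0.
have [|] := FF t; first by rewrite -ltn_predRL.
set U := nth _ F t.+1; set W := nth _ F t; move=> WU _.
have /(iso_subquotP _ WU)[g gP] := labP t tF.
have dU := cdim_presents (ee k) gP; rewrite cdim_Delta in dU.
move: (IH (ltnW tF)) dU; rewrite big_ord_recr /= -/W -/U.
case: (boolP (lab t \in G)) => lG /= IH' dU; last first.
  rewrite dU addnA leq_add2r; apply: leq_trans IH' _; rewrite leq_add2r.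
  exact/cdimS/trvS.
have [gh gs gk] := gP; have [x ex gx] := Delta_gen hA (lab t).
(* The generator of Delta(l) lifts to x' in U, and A e_l x' lies in the trace, so u can be corrected
   by it modulo W. *)
have UX : (U <= trv G U + W)%VS.
  apply/subvP => u Uu; have /memv_imgP[x' Ux' xE] : x \in (g @: U)%VS by rewrite gs memvf.
  have [a ua] := gx (g u).
  rewrite -[u](subrK (act (a * e (lab t)) x')) addrC; apply: memv_add.
    by apply: (subvP (tr_trv _ _ lG)); apply: mem_tr.
  have Ux : act (a * e (lab t)) x' \in (U : {vspace M}) by apply: stable_sub.
  rewrite -(presents_eq0 gP (memvB Uu Ux)).
  have -> : g (u - act (a * e (lab t)) x') = g u - g (act (a * e (lab t)) x') by exact: linearB.
  by rewrite (gh _ _ Ux') -xE actM ex -ua subrr.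
have H1 := dimv_sum_cap (actf _ (e k) @: trv G U)%VS (actf _ (e k) @: W)%VS.
have := dimvS (limgS (actf _ (e k)) UX); rewrite limgD => H2.
have : (actf _ (e k) @: trv G W <= actf _ (e k) @: trv G U :&: actf _ (e k) @: W)%VS.
  by rewrite subv_cap !limgS ?trvS //; apply/trv_subP => i _; apply: tr_sub.
move/dimvS => H3; rewrite addn0; move: H1 H2 H3 IH'; rewrite /cdim.
move: (\dim _) (\dim _) (\dim _) (\dim _) (\dim _) (\dim _) (\sum_(_ < _) _)%N.
by move=> *; lia.
Qed.

End DeltaFiltration.

(** The dimension vector of M determines the multiplicities by [upper_sum_inj], so all
    Delta-filtrations of M have the same ones. *)
Lemma Delta_multE (M : module A) (F : seq (submodule M)) i :
  filtration (fun N => exists k, iso N (Delta k)) F ->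
  Delta_mult phi M i = factor_count F (Delta i).
Proof.
move=> FD; rewrite /Delta_mult /multiplicity; case: xgetP => [m _ [F' F'D ->]|no].
  apply: (@upper_sum_inj _ _ (fun i => factor_count F' (Delta i)) (fun i => factor_count F (Delta i))).
  by move=> k; rewrite -!cdim_Delta_filtration.
by case: (no (factor_count F (Delta i))); exists F.
Qed.

Lemma Delta_filtration_Pmod j : exists2 F : seq (submodule (P j)),
  filtration (fun N => exists k, iso N (Delta k)) F &
  forall i, factor_count F (Delta i) = (j <= i)%O.
Proof.
have [/(_ j)[_ [F FD] nl _] _ hD _ _] := hq; exists F => // i.
rewrite -Delta_multE //; case: (boolP (j <= i)%O) => ji; last exact: nl.
by have [_ ->] := hD i j ji.
Qed.

Lemma cdim_Pmod j k : cdim (e k) (full (P j)) = #|Lambda j :&: Lambda k|.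
Proof.
have [F FD FC] := Delta_filtration_Pmod j; rewrite (cdim_Delta_filtration FD).
rewrite (eq_bigr (fun i => (j <= i)%O && (k <= i)%O : nat)) ?sum_nat_card => [|i _].
  by apply: eq_card => i; rewrite !inE.
by rewrite FC mulnb andbC.
Qed.

Lemma cdim_trv_lower (G : {set V}) j k : (cdim (e k) (full (P j)) <=
  cdim (e k) (trv G (full (P j))) + #|(Lambda j :&: Lambda k) :\: G|)%N.
Proof.
have [F FD FC] := Delta_filtration_Pmod j; have [lab labP] := Delta_labels FD.
have -> : #|(Lambda j :&: Lambda k) :\: G| =
    (\sum_(t < (size F).-1) ((lab t \notin G) && (k <= lab t)%O))%N.
  rewrite (sum_label (fun i => (i \notin G) && (k <= i)%O : nat) labP).
  rewrite (eq_bigr (fun i => i \in (Lambda j :&: Lambda k) :\: G : nat)).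
    by rewrite sum_nat_card; apply: eq_card => i; rewrite !inE.
  by move=> i _; rewrite FC !inE mulnb; case: (i \notin G); case: (j <= i)%O; case: (k <= i)%O.
have := cdim_trv_filtration FD G k labP (leqnn _).
by have [_ _ -> _] := FD.
Qed.

(** * Simple socles, P(1) = I(1), and the copies of P(i) in P(j) *)

Lemma iso_chi_module i (N N' : module A) : iso N N' -> chi_module hA i N' -> chi_module hA i N.
Proof.
move=> [f [/embedding_inj fi sf]] [d1 cN]; split.
  have /eqP kf : lker f == 0%VS by apply/lker0P.
  by rewrite -(limg_ker_dim f fullv) kf capv0 dimv0 sf d1.
by move=> a v; apply: fi; rewrite hom_act cN linearZ.
Qed.

Lemma chi_module_eigen i (M : module A) (W : submodule M) (v : M) : v != 0 ->
  (forall a, act a v = chi i a *: v) -> sub_space W = <[v]>%VS -> chi_module hA i (submod W).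
Proof.
move=> v0 av Wv; have vW : v \in (W : {vspace M}) by rewrite Wv memv_line.
have w0 : subf W v != 0.
  by apply: contraNneq v0 => w0; rewrite -(subfK vW) w0 linear0.
apply: (chi_module_line w0) => [|a].
  by apply/eqP; rewrite eqEdim subvf dim_vline w0 dimvf [dim _](congr1 (fun X => \dim X) Wv) dim_vline v0.
by rewrite -subf_act // av linearZ.
Qed.

Lemma Pmod_socle j : exists s : P j, [/\ s != 0, forall a, act a s = chi one a *: s &
  forall U : submodule (P j), sub_space U <> 0%VS -> s \in (U : {vspace P j})].
Proof.
have [_ _ _ /(_ j)[+ _] _] := hq => /iso_chi_module/(_ (Smod_chi hA one)).
set S := soc (P j) => -[d1 cS]; rewrite dimvf in d1.
pose s := vpick S; have sS : s \in (S : {vspace P j}) by apply: memv_pick.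
have dS : \dim S = 1%N by [].
have s0 : s != 0 by rewrite vpick0 -dimv_eq0 dS.
have Ss : sub_space S = <[s]>%VS.
  by apply/esym/eqP; rewrite eqEdim -memvE sS dim_vline s0 dS.
exists s; split=> // [a|U U0].
  by rewrite -(subfK sS) -[LHS]submod_actE -linearZ; congr vsval; apply: cS.
(* An eigenvector inside U spans a simple submodule. It lies in the one-dimensional socle, hence
   spans it. *)
have [|i [w [w0 aw]]] := eigenvector hA (M := submod U).
  by move/(congr1 (fun X => \dim X)); rewrite dimvf dimv0 => /eqP; rewrite [_ == _](dimv_eq0 U) => /eqP.
have aw' a : act a (vsval w) = chi i a *: vsval w.
  by rewrite -[LHS]submod_actE -linearZ; congr vsval; apply: aw.
have w0' : vsval w != 0 by [].
have sW : stable <[vsval w]>%VS.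
  by move=> a _ /vlineP[c ->]; rewrite actZr aw'; do 2!apply: memvZ; apply: memv_line.
pose W := Sub_module sW.
have WU : (W <= U)%VS by rewrite /= -memvE subvsP.
have WS : (W <= S)%VS.
  by apply: soc_sub; apply: (@chi_simple _ _ _ _ _ _ hA i); apply: chi_module_eigen aw' _.
apply: (subvP WU); suff -> : sub_space W = S by [].
by apply/eqP; rewrite eqEdim WS dS /= dim_vline w0'.
Qed.

(** The linear form l is nonzero on the socle vector s, so the map it induces does not kill s; a
    nonzero kernel would contain s. *)
Lemma Pmod_emb_Imod j : exists f : modhom (P j) (I one), embedding f.
Proof.
have [s [s0 as_ sU]] := Pmod_socle j.
have [l ls] := functional_neq0 s0.
have [f fl] := Ihom_ex phi one l; exists f; apply: contrapT => k0.
have := sU (hker f) k0; rewrite memv_ker => /eqP/fl/(_ 1).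
rewrite mulr1 as_ linearZ /= (chi_idem hA) eqxx => /eqP; rewrite [_ *: _]mul1r.
by rewrite (negPf ls).
Qed.

Lemma cdim_Imod j k : cdim (e k) (full (I j)) = #|Lambda j :&: Lambda k|.
Proof.
have := cdim_rejv_Imod phi finset.set0 j k; rewrite trv_set0 rejv_set0.
have -> : cdim (e j) (sub0 (P k)) = 0%N by apply: cdim0.
rewrite addn0 => E; apply: etrans E _.
by rewrite cdim_Pmod finset.setIC.
Qed.

Lemma cdim_limg_emb (M N : module A) (f : modhom M N) (W : submodule N) k :
  embedding f -> limg f = sub_space W -> cdim (e k) W = cdim (e k) (full M).
Proof.
move=> ef fW; rewrite -(cdim_submod (ee k) W); apply/esym/cdim_iso => //.
apply: iso_trans (_ : iso (submod (subT M)) _); first exact/iso_sym/iso_subT.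
exact: iso_himg ef _.
Qed.

Lemma iso_Pmod_Imod_one : iso (P one) (I one).
Proof.
have [f ef] := Pmod_emb_Imod one; exists f; split=> //.
apply: (@eq_cdim _ _ _ _ _ phi _ (himg f (subT _)) (subT _)); first exact: subvf.
move=> k; rewrite (cdim_limg_emb k ef (W := himg f (subT _))) //.
by rewrite cdim_Pmod [X in (X <= _)%N]cdim_Imod.
Qed.

Lemma Pmod_emb j : exists f : modhom (P j) (P one), embedding f.
Proof.
have [f /embedding_inj fi] := Pmod_emb_Imod j.
have [g [/embedding_inj gi _]] := iso_sym iso_Pmod_Imod_one.
have [h hE] := modhom_comp g f; exists h; apply/embedding_inj => x y.
by rewrite !hE => /gi/fi.
Qed.

Lemma eimg_le (M : module A) (U W : submodule M) i m : (U <= W)%VS ->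
  cdim (e i) W = m -> (m <= cdim (e i) U)%N -> (actf M (e i) @: W <= U)%VS.
Proof. by move=> UW <-; apply: (eimg_eq (ee i)) UW; apply: stableP. Qed.

(** For j <= i the dimension of e_i P(j) is |Λ(i)|, independently of j, so a submodule this large at
    i contains all of e_i P(j). *)
Lemma tr_Pmod_sub (i j : V) (U : submodule (P j)) : (j <= i)%O ->
  (#|Lambda i| <= cdim (e i) U)%N -> (tr (e i) (full (P j)) <= U)%VS.
Proof.
move=> ji dU; apply: (@tr_eimg_sub _ _ _ _ (subT _)); first exact: stableP.
apply: (eimg_le (W := subT _) (subvf _) _ dU).
by apply: etrans (cdim_Pmod j i) _; rewrite finset.setIC card_LambdaI.
Qed.

Lemma Pmod_emb_eimg i j (f : modhom (P j) (P one)) : (j <= i)%O -> embedding f ->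
  (actf (P one) (e i) @: fullv <= limg f)%VS.
Proof.
move=> ji ef; apply: (eimg_le (U := himg f (subT _)) (W := subT _) (m := #|Lambda i|)).
- exact: subvf.
- apply: etrans (cdim_Pmod one i) _.
  by rewrite finset.setIC (card_LambdaI (one_le i)).
- apply: eq_leq; apply/esym; apply: etrans (cdim_limg_emb i ef (W := himg f (subT _)) erefl) _.
  by rewrite cdim_Pmod finset.setIC card_LambdaI.
Qed.

(** P(j) and P(i) are both embedded in P(1). Each image contains all of e_i P(1), so tr_i P(j) and
    P(i) are both mapped onto tr_i P(1). *)
Lemma iso_tr_Pmod i j : (j <= i)%O -> iso (submod (tr (e i) (full (P j)))) (P i).
Proof.
move=> ji; have [h eh] := Pmod_emb j; have [f ef] := Pmod_emb i.
pose T := tr (e i) (full (P one)).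
have hT : (h @: tr (e i) (full (P j)))%VS = sub_space T.
  apply: subv_anti; apply/andP; split.
    have s : (tr (e i) (full (P j)) <= h @^-1: T)%VS.
      apply/(@tr_subP _ _ _ _ (subT _)) => a v _.
      by rewrite -memv_preim hom_act; apply: mem_tr; apply: memvf.
    apply/subvP => _ /memv_imgP[u uT ->].
    by apply: etrans (memv_preim h u (sub_space T)) _; apply: (subvP s).
  apply/(@tr_subP _ _ _ _ (subT _)) => a v _.
  have /memv_imgP[y _ yE] : act (e i) v \in limg h.
    by apply: (subvP (Pmod_emb_eimg ji eh)); rewrite -actfE memv_img ?memvf.
  have -> : act (a * e i) v = h (act (a * e i) y).
    by rewrite hom_act -yE -[RHS]actM -mulrA ee.
  by rewrite memv_img // mem_tr ?memvf.
have fT : (f @: subT (P i))%VS = sub_space T.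
  apply: subv_anti; apply/andP; split.
    apply/subvP => _ /memv_imgP[u _ ->]; rewrite [u]PE hom_act -(act_genP phi i) hom_act -actM.
    by rewrite mem_tr ?memvf.
  apply: (@tr_eimg_sub _ _ _ _ (subT _)); first exact: (@stable_img _ _ _ _ f (subT _)).
  exact: Pmod_emb_eimg.
apply: iso_trans (iso_himg eh hT) _.
apply: iso_trans (iso_sym (iso_himg ef fT)) _; exact: iso_subT.
Qed.

Lemma cdim_tr_Pmod i j k : (j <= i)%O ->
  cdim (e k) (tr (e i) (full (P j))) = #|Lambda i :&: Lambda k|.
Proof.
move=> ji; apply: etrans (esym (cdim_submod (ee k) _)) _.
exact: etrans (cdim_iso (ee k) (iso_tr_Pmod ji)) (cdim_Pmod i k).
Qed.

Lemma tr_unique i j (U : submodule (P j)) : (j <= i)%O -> iso (submod U) (P i) ->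
  U = tr (e i) (full (P j)).
Proof.
move=> ji iU; have dU k : cdim (e k) U = #|Lambda i :&: Lambda k|.
  apply: etrans (esym (cdim_submod (ee k) _)) _.
  exact: etrans (cdim_iso (ee k) iU) (cdim_Pmod i k).
apply: submodule_eq; apply/esym; apply: (eq_cdim (phi := phi)) => [|k]; last first.
  by apply: eq_leq; apply: etrans (dU k) (esym (cdim_tr_Pmod k ji)).
by apply: tr_Pmod_sub => //; rewrite dU finset.setIid.
Qed.

Lemma PsubE i j : (j <= i)%O -> Psub phi j i = tr (e i) (full (P j)).
Proof.
move=> ji; rewrite /Psub; case: xgetP => [U _ /= iU|no]; first exact: tr_unique.
by case: (no (tr (e i) (full (P j)))); apply: iso_tr_Pmod.
Qed.

(** * Dimensions of the traces of P(j) *)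

Lemma trv_D1 j (B : {set V}) i : i \in B ->
  sub_space (trv B (full (P j))) = (trv (B :\ i) (full (P j)) + tr (e i) (full (P j)))%VS.
Proof.
move=> iB; rewrite !trvE (bigD1 i) //= addvC; congr (_ + _)%VS.
by apply: eq_bigl => l; rewrite !inE andbC.
Qed.

(** The lower bound comes from the Delta-filtration. The upper bound removes a minimal i and
    estimates from below what the two summands share. *)
Lemma cdim_trv_sub (G : {set V}) j k : upset G -> G \subset Lambda j ->
  cdim (e k) (trv G (full (P j))) = #|G :&: Lambda k|.
Proof.
have lower (G' : {set V}) : G' \subset Lambda j ->
    (#|G' :&: Lambda k| <= cdim (e k) (trv G' (full (P j))))%N.
  move=> sG; have := cdim_trv_lower G' j k; rewrite cdim_Pmod.
  rewrite -(cardsID G' (Lambda j :&: Lambda k)) leq_add2r; apply: leq_trans.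
  by rewrite (finset.setIC _ G') finset.setIA (finset.setIidPl sG).
move: {2}#|G| (leqnn #|G|) => n; elim: n G => [|n IH] G Gn uG sG.
  move: Gn; rewrite leqn0 cards_eq0 => /eqP ->.
  by rewrite trv_set0 cdim0 finset.set0I cards0.
have [->|[x xG]] := set_0Vmem G; first by rewrite trv_set0 cdim0 finset.set0I cards0.
have [i imin] := minimal_exists xG; have iG := imin.1.
have ji : (j <= i)%O by have := fintype.subsetP sG _ iG; rewrite inE.
pose G' := G :\ i.
have sG'G : G' \subset G by apply: subD1set.
have uG' : upset G' by apply: upset_D1.
have G'n : (#|G'| <= n)%N by move: Gn; rewrite (cardsD1 i G) iG.
have IH' := IH G' G'n uG' (fintype.subset_trans sG'G sG).
apply/eqP; rewrite eqn_leq lower // andbT.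
have trE : sub_space (trv G (full (P j))) = (trv G' (full (P j)) + tr (e i) (full (P j)))%VS.
  exact: trv_D1.
(* The trace of [H], the elements strictly above i, lies in both summands. Its lower bound makes
   tr_i contribute at most [k <= i] beyond tr_{G - i}. *)
pose H := Lambda i :\ i.
have sHG : H \subset G'.
  apply/fintype.subsetP => l; rewrite !inE => /andP[li il]; rewrite li.
  exact: uG iG il.
have sHL : H \subset Lambda j := fintype.subset_trans sHG (fintype.subset_trans sG'G sG).
have capH : (actf _ (e k) @: trv H (full (P j)) <=
    actf _ (e k) @: trv G' (full (P j)) :&: actf _ (e k) @: tr (e i) (full (P j)))%VS.
  rewrite subv_cap !limgS //; apply/trv_subP => l lH; last first.
    by apply: tr_trv; apply: (fintype.subsetP sHG).
  have il : (i <= l)%O by move: lH; rewrite !inE => /andP[].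
  apply: tr_Pmod_sub; first exact: le_trans il.
  by rewrite cdim_tr_Pmod // finset.setIC card_LambdaI.
have cardG : #|G :&: Lambda k| = (#|G' :&: Lambda k| + (k <= i)%O)%N := card_upset_D1 k iG.
have iL : i \in Lambda i by rewrite inE.
have cardL : #|Lambda i :&: Lambda k| = (#|H :&: Lambda k| + (k <= i)%O)%N := card_upset_D1 k iL.
have H1 := dimv_sum_cap (actf _ (e k) @: trv G' (full (P j)))%VS (actf _ (e k) @: tr (e i) (full (P j)))%VS.
have H2 := dimvS capH; have H3 := lower H sHL; have H4 := cdim_tr_Pmod k ji.
rewrite trE cardG; move: H1 H2 H3 H4 IH'; rewrite /cdim limgD cardL.
move: (\dim _) (\dim _) (\dim _) (\dim _) (\dim _) => a1 a2 a3 a4 a5 H1 H2 H3 H4 IH'.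
by lia.
Qed.

Lemma cdim_trv_Pmod (G : {set V}) j k : upset G ->
  cdim (e k) (trv G (full (P j))) = #|G :&: Lambda j :&: Lambda k|.
Proof.
move=> uG; have uGj : upset (G :&: Lambda j).
  move=> x y; rewrite !inE => /andP[xG jx] xy.
  by rewrite (uG _ _ xG xy) (le_trans jx xy).
rewrite -(cdim_trv_sub _ uGj (finset.subsetIr _ _)); congr (cdim _ _).
apply: subv_anti; apply/andP; split; apply/trv_subP => i iG; last first.
  by apply: tr_trv; case/finset.setIP: iG.
apply: (@tr_eimg_sub _ _ _ _ (subT _)); first exact: stableP.
apply: (eimg_le (W := subT _) (subvf _) (cdim_Pmod j i)).
(* For i in the upset G, all of Λ(i) lies in G, so the trace of G ∩ Λ(j) already contains the whole
   of e_i P(j). *)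
rewrite cdim_trv_sub ?finset.subsetIr //; apply: subset_leq_card.
by apply/fintype.subsetP => l; rewrite !inE => /andP[-> il]; rewrite il (uG _ _ iG il).
Qed.

Lemma tr_Pmod_le i i' j : (j <= i')%O -> (i' <= i)%O ->
  (tr (e i) (full (P j)) <= tr (e i') (full (P j)))%VS.
Proof.
move=> ji ii; apply: tr_Pmod_sub; first exact: le_trans ii.
by rewrite cdim_tr_Pmod // finset.setIC card_LambdaI.
Qed.

Lemma trv_Lambda j : trv (Lambda j) (full (P j)) = subT (P j).
Proof.
apply: submodule_eq; apply: eq_fullv.
have jL : j \in Lambda j by rewrite inE.
apply: subv_trans (tr_trv _ _ jL); apply/subvP => y _.
by rewrite [y]PE -(act_genP phi j) -actM mem_tr ?memvf.
Qed.

(** * Delta-steps between traces *)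

Definition Dstep j (U W : submodule (P j)) i := (W <= U)%VS /\ iso (subquot U W) (Delta i).

Lemma tr_Pmod_gen i j : (j <= i)%O -> exists2 x : P j,
  x \in (tr (e i) (full (P j)) : {vspace P j}) /\ act (e i) x = x &
  forall u, u \in (tr (e i) (full (P j)) : {vspace P j}) -> exists a, u = act a x.
Proof.
move=> ji; have [f [_ sf]] := iso_sym (iso_tr_Pmod ji).
exists (vsval (f (genP phi i))); first split; first exact: subvsP.
  have fe : act (e i) (f (genP phi i)) = f (genP phi i) by rewrite -hom_act act_genP.
  by rewrite -[LHS]submod_actE; exact: (f_equal vsval fe).
move=> u uT; have /memv_imgP[y _ yE] : subf _ u \in limg f by rewrite sf memvf.
have fy : f y = act (vsval y) (f (genP phi i)) := etrans (f_equal f (PE y)) (hom_act f _ _).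
exists (vsval y); apply: etrans (esym (subfK uT)) _.
by apply: etrans (f_equal vsval (etrans yE fy)) _; apply: submod_actE.
Qed.

Lemma Dstep_ex j (B : {set V}) i : upset B -> B \subset Lambda j -> minimal_in i B ->
  Dstep (trv B (full (P j))) (trv (B :\ i) (full (P j))) i.
Proof.
move=> uB sB iB; have iB' := iB.1.
set U := trv B _; set W := trv (B :\ i) _.
have UE : sub_space U = (W + tr (e i) (full (P j)))%VS by apply: trv_D1.
have WU : (W <= U)%VS by rewrite UE addvSl.
split=> //; have [g gP] := presents_subquot WU; have [gh gs _] := gP.
have ji : (j <= i)%O by have := fintype.subsetP sB i iB'; rewrite inE.
have [x [xT ex] gx] := tr_Pmod_gen ji.
have xU : x \in (U : {vspace P j}) by rewrite UE; apply: (subvP (addvSr _ _)).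
have dU k : cdim (e k) U = #|B :&: Lambda k| := cdim_trv_sub k uB sB.
have dW k : cdim (e k) W = #|(B :\ i) :&: Lambda k|.
  apply: (cdim_trv_sub k (upset_D1 uB iB)).
  exact: fintype.subset_trans (subD1set _ _) sB.
apply: (Delta_criterion (v := g x)) => [|y|k].
- by rewrite -gh // ex.
- have /memv_imgP[u + ->] : y \in (g @: U)%VS by rewrite gs memvf.
  rewrite UE => /memv_addP[w wW [t tT ->]]; have [a ta] := gx t tT.
  have gw : g w = 0 by apply/eqP; rewrite (presents_eq0 gP (subvP WU w wW)); exact: wW.
  have -> : g (w + t) = g w + g t by exact: linearD.
  by exists a; rewrite gw add0r ta (gh _ _ xU).
have := cdim_presents (ee k) gP; rewrite dU dW (card_upset_D1 k iB').
by move/addnI.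
Qed.

Lemma Dstep_label j (U W : submodule (P j)) i i' : Dstep U W i -> Dstep U W i' -> i = i'.
Proof.
by move=> [_ a] [_ b]; apply: Delta_inj; apply: iso_trans b; apply: iso_sym.
Qed.

Lemma Dstep_inv j (B : {set V}) (W : submodule (P j)) l : upset B -> B \subset Lambda j ->
  Dstep (trv B (full (P j))) W l ->
  minimal_in l B /\ W = trv (B :\ l) (full (P j)).
Proof.
move=> uB sB [WU iU]; set U := trv B _ in WU iU.
have [g gP] := (iso_subquotP _ WU).1 iU; have [gh gs _] := gP.
have [t [t0 ta]] := Delta_functional hA l.
have trU i : i \in B -> (tr (e i) (full (P j)) <= U)%VS by apply: tr_trv.
have eU i u : i \in B -> act (e i) u \in (U : {vspace P j}).
  by move=> iB; apply: (subvP (trU i iB)); have := mem_tr (e i) 1 (memvf u); rewrite mul1r.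
have ge i u : i \in B -> g (act (e i) u) = act (e i) (g (act (e i) u)).
  by move=> iB; rewrite -gh ?eU // -actM ee.
have lmin : minimal_in l B.
  apply: contrapT => nmin; case/eqP: t0; apply/lfunP => y; rewrite zero_lfunE.
  have /memv_imgP[u uU ->] : y \in (g @: U)%VS by rewrite gs memvf.
  (* As g is onto, killing all of U would make the form t vanish on Delta(l). *)
  suff sU : (U <= lker (t \o g))%VS.
    by have := subvP sU u uU; rewrite memv_ker comp_lfunE => /eqP.
  have kill i : i \in B -> i != l -> (tr (e i) (full (P j)) <= lker (t \o g))%VS.
    move=> iB il; apply/(@tr_subP _ _ _ _ (subT _)) => a v _.
    rewrite memv_ker comp_lfunE actM gh ?eU // ge // -actM ta (chiM hA) (chi_idem hA).
    by rewrite (negPf il) mulr0 mul0r.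
  (* For i different from l, [chi l] kills e_i. If l itself lies in B but is not minimal, then tr_l
     is contained in tr_{i'} for some i' < l in B, which is killed. *)
  apply/trv_subP => i iB; have [il|] := eqVneq i l; last exact: kill.
  have [i' i'B [i'l ne]] : exists2 i', i' \in B & (i' <= i)%O /\ i' != l.
    apply: contrapT => no; apply: nmin; split; first by rewrite -il.
    move=> i' i'B i'l; apply/eqP; apply: contraT => ne; case: no; exists i' => //.
    by rewrite il.
  apply: subv_trans (kill i' i'B ne); apply: tr_Pmod_le => //.
  by have := fintype.subsetP sB i' i'B; rewrite inE.
split=> //; have lB := lmin.1; apply: submodule_eq; apply/esym; apply: (eq_cdim (phi := phi)) => [|k].
  apply/trv_subP => i; rewrite !inE => /andP[il iB].
  apply: (@tr_eimg_sub _ _ _ _ (subT _)); first exact: stableP.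
  (* By minimality of l no i in B - l lies below l, so e_i Delta(l) = 0 and e_i P(j) falls into the
     kernel W. *)
  apply/subvP => _ /memv_imgP[u _ ->]; rewrite actfE -(presents_eq0 gP) ?eU // ge //.
  rewrite (@cdim_eq0 _ _ _ _ _ phi _ fullv i _ _ (memvf _)) //.
  rewrite cdim_Delta; case: (boolP (i <= l)%O) => // /(lmin.2 _ iB) E.
  by rewrite E eqxx in il.
have sB' : B :\ l \subset Lambda j := fintype.subset_trans (subD1set _ _) sB.
have := cdim_presents (ee k) gP; rewrite cdim_Delta.
have -> : cdim (e k) U = #|B :&: Lambda k| := cdim_trv_sub k uB sB.
have -> : cdim (e k) (trv (B :\ l) (full (P j))) = #|(B :\ l) :&: Lambda k|.
  exact: (cdim_trv_sub k (upset_D1 uB lmin) sB').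
by rewrite (card_upset_D1 k lB) => /addIn ->.
Qed.

Lemma trv_inj0 j (B : {set V}) : B \subset Lambda j ->
  trv B (full (P j)) = trv finset.set0 (full (P j)) -> B = finset.set0.
Proof.
move=> sB E; apply/eqP; rewrite -finset.subset0; apply/fintype.subsetP => i iB.
have ji : (j <= i)%O by have := fintype.subsetP sB i iB; rewrite inE.
have : (tr (e i) (full (P j)) <= 0)%VS.
  have -> : (0%VS : {vspace P j}) = trv B (full (P j)).
    by rewrite E trv_set0.
  exact: tr_trv.
rewrite subv0 => /eqP T0; have := cdim_tr_Pmod i ji; rewrite T0 cdim0.
move/esym/eqP; rewrite cards_eq0 => /eqP/finset.setP/(_ i).
by rewrite !inE lexx.
Qed.

Lemma DsubE j (s : #|Lambda j|.-tuple V) t : calL j s ->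
  Dsub phi j s t = trv (tailset s t) (full (P j)).
Proof.
move=> sL; have js m : (j <= tnth s m)%O by have [/(_ m)] := sL; rewrite inE.
apply: submodule_eq; rewrite /Dsub big_subD; apply: subv_anti; apply/andP; split.
  apply/subv_sumP => m tm; rewrite PsubE //.
  by apply: tr_trv; apply/tailsetP; exists m.
apply/trv_subP => _ /tailsetP[m tm ->].
by rewrite -(PsubE (js m)); apply: (sumv_sup m).
Qed.

(** * Rejects of I(j) and the modules nabla(i) *)

Lemma cdim_rejv (B : {set V}) j k : upset B ->
  cdim (e k) (rejv (I j) B) = #|(Lambda j :&: Lambda k) :\: B|.
Proof.
move=> uB; have := cdim_rejv_Imod phi B j k.
rewrite (cdim_trv_Pmod k j uB) (cdim_Pmod k j).
rewrite -(cardsID B (Lambda k :&: Lambda j)) addnC.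
have -> : B :&: Lambda k :&: Lambda j = (Lambda k :&: Lambda j) :&: B.
  by rewrite -finset.setIA finset.setIC.
by move/addnI ->; rewrite (finset.setIC (Lambda k)).
Qed.

Lemma cdim_Nabla i k : cdim (e k) (full (Nabla i)) = (k <= i)%O.
Proof.
rewrite NablaE //; apply: etrans (cdim_submod (ee k) _) _.
rewrite cdim_rejv; last first.
  by move=> x y; rewrite !inE => xi xy; apply: contra xi; apply: le_trans.
have -> : (Lambda i :&: Lambda k) :\: noncomp_le i = if (k <= i)%O then [set i]%SET else finset.set0.
  apply/finset.setP => l; rewrite !inE negbK; case: ifP => ki; rewrite !inE.
    apply/andP/eqP => [[li /andP[il _]]|->]; last by rewrite !lexx ki.
    by apply: le_anti; rewrite li.
  apply/negP => /andP[li /andP[il kl]].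
  by move/negP: ki; apply; apply: le_trans li.
by case: ifP; rewrite ?cards1 ?cards0.
Qed.

(** A form that is nonzero on the line e_i N gives a map N -> I(i) whose kernel is the reject of
    e_i, here zero. The image lies in nabla(i) by maximality and has the same dimension vector. *)
Lemma Nabla_criterion (N : module A) i :
  (forall v : N, (forall a, act (e i * a) v = 0) -> v = 0) ->
  (forall k, cdim (e k) (full N) = (k <= i)%O) -> iso N (Nabla i).
Proof.
move=> rN dN; have d1 := dN i; rewrite lexx in d1.
pose b := vpick (actf N (e i) @: fullv)%VS.
have b0 : b != 0 by rewrite vpick0 -dimv_eq0 [\dim _]d1.
have bE : (actf N (e i) @: fullv)%VS = <[b]>%VS.
  by apply/esym/eqP; rewrite eqEdim -memvE memv_pick dim_vline b0 [\dim _]d1.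
have [l lb] := functional_neq0 b0; have [f fl] := Ihom_ex phi i l.
have f0 v : f v = 0 -> v = 0.
  move/fl => lv; apply: rN => a; have := lv a.
  have : act (e i * a) v \in <[b]>%VS by rewrite -bE actM -actfE memv_img ?memvf.
  case/vlineP => c ->; have -> : l (c *: b) = c *: l b by exact: linearZ.
  by move/eqP; rewrite scaler_eq0 (negPf lb) orbF => /eqP ->; rewrite scale0r.
have ef : embedding f.
  apply/eqP; rewrite -subv0; apply/subvP => v; rewrite memv_ker memv0 => /eqP/f0 ->.
  exact: eqxx.
have dF k := cdim_limg_emb k ef (W := himg f (subT _)) erefl.
have -> : Nabla i = submod (himg f (subT _)); last first.
  by apply: iso_trans (iso_sym (iso_subT N)) _; apply: iso_himg ef _.
rewrite NablaE //; congr submod; apply/esym/submodule_eq; apply: (eq_cdim (phi := phi)) => [|k].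
  have [_ g] := NablaU_greatest hA i; apply: g; apply/(bounded_factorsP hA) => k ki.
  apply: etrans (cdim_submod (ee k) _) _; apply: etrans (dF k) _.
  by rewrite dN (negPf ki).
apply: eq_leq; apply: etrans _ (esym (etrans (dF k) (dN k))).
by apply: etrans (esym (cdim_submod (ee k) _)) _; rewrite -NablaE // cdim_Nabla.
Qed.

(** Some eigenvector exists; with a character other than [chi l] it would be killed by e_l A, which
    is impossible for a nonzero vector of I(l). *)
Lemma Nabla_eigen l : exists2 s : Nabla l, s != 0 & forall a, act a s = chi l a *: s.
Proof.
have N0 : full (Nabla l) <> 0%VS.
  move=> E; have := cdim_Nabla l l; rewrite lexx E.
  by rewrite (cdim0 (e l) (Nabla l)).
have [i [s [s0 as_]]] := eigenvector hA N0.
suff il : i = l by exists s => // a; rewrite as_ il.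
apply/eqP; apply: contraT => il; case/eqP: s0.
have {as_} : forall a, act (e l * a) s = 0.
  by move=> a; rewrite as_ (chiM hA) (chi_idem hA) eq_sym (negPf il) mul0r scale0r.
move: s {N0}; rewrite NablaE // => s s0; apply: subvs_inj.
have := @Imod_soc _ _ _ _ _ phi l (vsval s); rewrite linear0; apply => a.
by rewrite -[LHS]submod_actE; apply: (f_equal vsval (s0 a)).
Qed.

(** * The surjections P(1) ->> I(j) and their kernels *)

Lemma Imod_surj j : exists f : modhom (P one) (I j), surjection f.
Proof.
have [_ _ _ /(_ j)[_ it] _] := hq.
have [g gP] := (iso_quotmodP _ _).1 it; have [gh gs _] := gP.
have [d1 cS] := Smod_chi hA one.
pose b := vpick (full (Smod phi one)).
have b0 : b != 0 by rewrite vpick0 -dimv_eq0 d1.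
have /memv_imgP[w _ wb] : b \in (g @: fullv)%VS by rewrite gs memvf.
pose v := act (e one) w.
have gv : g v = b by rewrite /v gh ?memvf // -wb cS (chi_idem hA) eqxx scale1r.
have ev : act (e one) v = v by rewrite -actM ee.
have [f fv] := Phom_ex ev; exists f; apply: contrapT => nf.
(* Nakayama: v spans the one-dimensional top, so I(j) = <v> + rad. A maximal submodule containing
   the image of f would contain both. *)
have [W mW fW] := @maximal_exists _ _ _ (himg f (subT _)) nf.
case: mW.1; apply: eq_fullv; apply/subvP => y _.
have vW : v \in (W : {vspace I j}) by apply: (subvP fW); rewrite -fv memv_img ?memvf.
have bf : <[b]>%VS = full (Smod phi one) by apply/eqP; rewrite eqEdim subvf dim_vline b0 d1.
have /vlineP[c yc] : g y \in <[b]>%VS by rewrite bf memvf.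
rewrite -[y](subrK (c *: v)); apply: memvD; last exact: memvZ.
apply: (subvP (rad_sub mW)); rewrite -(presents_eq0 gP (memvf _)).
have -> : y - c *: v = (- c) *: v + y by rewrite scaleNr addrC.
have gl a u x : g (a *: u + x) = a *: g u + g x by exact: linearP.
by rewrite gl gv yc scaleNr addNr.
Qed.

Lemma cdim_hker i j (f : modhom (P one) (I j)) : surjection f -> (j <= i)%O ->
  cdim (e i) (hker f) = 0%N.
Proof.
move=> sf ji; have fP : presents (subT (P one)) (hker f) f by apply: presents_modhom.
have := cdim_presents (ee i) fP; rewrite cdim_Imod.
have -> : cdim (e i) (subT (P one)) = #|Lambda i|.
  by apply: etrans (cdim_Pmod one i) _; rewrite finset.setIC (card_LambdaI (one_le i)).
by rewrite finset.setIC card_LambdaI // -[LHS]add0n => /addIn.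
Qed.

(** For one inclusion, e_j P(1) and e_j I(j) have equal dimensions, so the kernel vanishes at j; for
    the other, I(j) has zero reject at e_j. The description does not mention f, so K(j) is
    independent of the surjection. *)
Lemma hker_Imod j (f : modhom (P one) (I j)) : surjection f -> hker f = rejs (P one) (e j).
Proof.
move=> sf; apply: submodule_eq; apply: subv_anti; apply/andP; split.
  by apply: sub_rej; apply/eqP; rewrite -dimv_eq0; apply/eqP/cdim_hker.
apply/subvP => y /rejP yj; rewrite memv_ker; apply/eqP/(@Imod_soc _ _ _ _ _ phi j) => a.
by rewrite -hom_act yj linear0.
Qed.

Lemma calKE i : calK phi one i = rejs (P one) (e i).
Proof.
rewrite /calK; case: xgetP => [U _ [f sf ->]|no]; first exact: hker_Imod.
have [f sf] := Imod_surj i; case: (no (rejs (P one) (e i))).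
by exists f => //; rewrite hker_Imod.
Qed.

(** The kernel of p vanishes at every i >= j, so whether e_i A kills a vector can be tested before
    or after applying p. *)
Lemma hom_rej i j (p : modhom (P one) (I j)) y : surjection p -> (j <= i)%O ->
  (p y \in rej (I j) (e i)) = (y \in rej (P one) (e i)).
Proof.
move=> sp ji; apply/rejP/rejP => r a; last by rewrite -hom_act r linear0.
rewrite -ee -mulrA actM; apply: (cdim_eq0 (U := hker p)); first exact: cdim_hker.
by rewrite memv_ker hom_act r.
Qed.

(** Lifted to P(1), the reject of e_{i'} is the kernel of a surjection onto I(i'), and this kernel
    vanishes at every i >= i'. *)
Lemma rej_Imod_le i i' j : (j <= i')%O -> (i' <= i)%O ->
  (rej (I j) (e i') <= rej (I j) (e i))%VS.
Proof.
move=> ji' i'i; have [p sp] := Imod_surj j; have [f sf] := Imod_surj i'.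
apply/subvP => x; have /memv_imgP[y _ ->] : x \in limg p by rewrite sp memvf.
move=> pyi; have yi : y \in rej (P one) (e i') := etrans (esym (hom_rej y sp ji')) pyi.
have yf : y \in (hker f : {vspace P one}) by rewrite (hker_Imod sf).
apply: etrans (hom_rej y sp (le_trans ji' i'i)) _; apply/rejP => a; rewrite actM.
by apply: (cdim_eq0 (U := hker f)); [exact: cdim_hker | exact: stable_sub].
Qed.

(** The smaller submodule comes first: removing an element from B enlarges the reject, so shrinking
    upsets give an ascending chain. *)
Definition Nstep j (W U : submodule (I j)) i := (W <= U)%VS /\ iso (subquot U W) (Nabla i).

Lemma Nstep_label j (W U : submodule (I j)) i i' : Nstep W U i -> Nstep W U i' -> i = i'.
Proof.
move=> [_ a] [_ b]; have ii := iso_trans (iso_sym a) b.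
have E k : (k <= i)%O = (k <= i')%O.
  have := etrans (esym (cdim_Nabla i k)) (etrans (cdim_iso (ee k) ii) (cdim_Nabla i' k)).
  by case: (k <= i)%O; case: (k <= i')%O.
by apply: le_anti; rewrite -E lexx E lexx.
Qed.

Lemma Nstep_ex j (B : {set V}) i : upset B -> B \subset Lambda j -> minimal_in i B ->
  Nstep (rejv (I j) B) (rejv (I j) (B :\ i)) i.
Proof.
move=> uB sB iB; have WU := rejvS phi (I j) (subD1set B i).
split=> //; have [g gP] := presents_subquot WU; have [gh gs _] := gP.
apply: Nabla_criterion => [w rw|k].
  have /memv_imgP[v vU wE] : w \in (g @: rejv (I j) (B :\ i))%VS by rewrite gs memvf.
  rewrite wE; apply/eqP; rewrite (presents_eq0 gP vU); apply/rejvP => i' i'B a.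
  have [->|ne] := eqVneq i' i; last first.
    by apply: (rejvP _ _ _ vU); rewrite !inE ne.
  have : act (e i * a) v \in (rejv (I j) B : {vspace I j}).
    rewrite -(presents_eq0 gP (stable_sub _ vU)) gh // -wE rw; exact: eqxx.
  by move/rejvP/(_ i iB.1 1); rewrite mulr1 -actM mulrA ee.
have := cdim_presents (ee k) gP; rewrite (cdim_rejv j k uB) (cdim_rejv j k (upset_D1 uB iB)).
by rewrite (card_upset_C1 k iB.1 sB) => /addnI.
Qed.

Lemma Nstep_inv j (B : {set V}) (W : submodule (I j)) l : upset B -> B \subset Lambda j ->
  Nstep (rejv (I j) B) W l -> minimal_in l B /\ W = rejv (I j) (B :\ l).
Proof.
move=> uB sB [WU iU]; set U := rejv _ _ in WU iU.
have [g gP] := (iso_subquotP _ WU).1 iU; have [gh gs _] := gP.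
have [s s0 as_] := Nabla_eigen l.
have UP y i : i \in B -> act (e i) y \in (U : {vspace I j}) -> act (e i) y = 0.
  by move=> iB /rejvP/(_ i iB 1); rewrite mulr1 -actM ee.
(* The socle vector s of nabla(l) is lifted to y in W. If l were not minimal in B, then y would lie
   in the reject of every i in B, hence in U, and s would be 0. *)
have lmin : minimal_in l B.
  apply: contrapT => nmin; case/eqP: s0.
  have /memv_imgP[y yW sE] : s \in (g @: W)%VS by rewrite gs memvf.
  rewrite sE; apply/eqP; rewrite (presents_eq0 gP yW).
  have kill i : i \in B -> i != l -> y \in rej (I j) (e i).
    move=> iB il; apply/rejP => a; rewrite actM; apply: UP => //; rewrite -actM.
    rewrite -(presents_eq0 gP (stable_sub _ yW)) gh // -sE as_ (chiM hA) (chi_idem hA).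
    by rewrite (negPf il) mul0r scale0r; apply: eqxx.
  apply/rejvP => i iB; apply/rejP; have [il|] := eqVneq i l; last exact: kill.
  have [i' i'B [i'l ne]] : exists2 i', i' \in B & (i' <= i)%O /\ i' != l.
    apply: contrapT => no; apply: nmin; split; first by rewrite -il.
    move=> i' i'B i'l; apply/eqP; apply: contraT => ne; case: no; exists i' => //.
    by rewrite il.
  apply: (subvP (rej_Imod_le _ i'l)) (kill i' i'B ne).
  by have := fintype.subsetP sB i' i'B; rewrite inE.
split=> //; apply: submodule_eq; apply: (eq_cdim (phi := phi)) => [|k].
  apply/subvP => y yW; apply/rejvP => i; rewrite !inE => /andP[il iB] a.
  rewrite actM; apply: UP => //; rewrite -actM.
  rewrite -(presents_eq0 gP (stable_sub _ yW)) gh // actM.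
  rewrite (@cdim_eq0 _ _ _ _ _ phi _ fullv i _ _ (memvf _)) //.
  rewrite cdim_Nabla; case: (boolP (i <= l)%O) => // /(lmin.2 _ iB) E.
  by rewrite E eqxx in il.
have := cdim_presents (ee k) gP; rewrite cdim_Nabla (cdim_rejv j k uB).
rewrite (cdim_rejv j k (upset_D1 uB lmin)) (card_upset_C1 k lmin.1 sB).
by move=> ->.
Qed.

Lemma rejv_Lambda j : rejv (I j) (Lambda j) = sub0 (I j).
Proof.
apply: submodule_eq; apply/eqP; rewrite -subv0; apply/subvP => y /rejvP yj.
by rewrite memv0; apply/eqP/(@Imod_soc _ _ _ _ _ phi j); apply: yj; rewrite inE.
Qed.

Lemma rejv_inj0 j (B : {set V}) : upset B -> B \subset Lambda j ->
  rejv (I j) B = rejv (I j) finset.set0 -> B = finset.set0.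
Proof.
move=> uB sB E; apply/eqP; rewrite -finset.subset0; apply/fintype.subsetP => i iB.
have ji : (j <= i)%O by have := fintype.subsetP sB i iB; rewrite inE.
have u0 : upset (finset.set0 : {set V}) by move=> x y; rewrite inE.
have := cdim_rejv j i uB; rewrite E (cdim_rejv j i u0) finset.setD0 => EC.
have /eqP/finset.setP/(_ i) : (Lambda j :&: Lambda i) :\: B == Lambda j :&: Lambda i.
  by rewrite eqEcard finset.subsetDl EC leqnn.
by rewrite !inE lexx ji iB.
Qed.

(** Each K(i) is the reject of e_i in P(1), so by [hom_rej] the intersection is the full preimage
    under p of the reject in I(j). *)
Lemma NsubE j (p : modhom (P one) (I j)) (s : #|Lambda j|.-tuple V) t : surjection p ->
  calL j s -> Nsub p s t = rejv (I j) (tailset s t).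
Proof.
move=> sp sL; have js m : (j <= tnth s m)%O by have [/(_ m)] := sL; rewrite inE.
rewrite /Nsub; set L := (X in himg p X).
have LP y : (y \in (L : {vspace P one})) = (p y \in (rejv (I j) (tailset s t) : {vspace I j})).
  rewrite /L big_subI memvE; apply/subv_bigcapP/rejvP => [yL _ /tailsetP[m tm ->] |yR m tm].
    by apply/rejP; rewrite hom_rej // -[_ \in _]/(y \in (rejs (P one) (e _) : {vspace P one})) -calKE memvE yL.
  rewrite -memvE calKE /= -(hom_rej _ sp) //; apply/rejP; apply: yR.
  by apply/tailsetP; exists m.
apply: submodule_eq; apply: subv_anti; apply/andP; split; apply/subvP => x.
  by case/memv_imgP => y yL ->; rewrite -LP.
have /memv_imgP[y _ ->] : x \in limg p by rewrite sp memvf.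
by rewrite -LP => yL; apply: memv_img.
Qed.

End OneQuasiHereditary.

(** * Good filtrations as enumerations of Λ(j) *)

Section GoodFiltrations.
Variables (K : fieldType) (d : Order.disp_t) (V : finPOrderType d) (Q : quiver V).
Variables (A : falgType K) (phi : {rmorphism path_algebra Q K -> A}).
Hypothesis hA : bound_quiver_algebra phi.
Variables one top : V.
Hypothesis hq : one_quasi_hereditary phi one top.
Local Notation P := (Pmod phi).
Local Notation I := (Imod phi).
Local Notation full M := (fullv : {vspace (carrier M)}).
Variable j : V.
Local Notation r := #|Lambda j|.

Let Dtr (B : {set V}) : submodule (P j) := trv phi B (full (P j)).
Let Nrej (B : {set V}) : submodule (I j) := rejv phi (I j) B.

Lemma Dsub_step s (t : 'I_r) : calL j s ->
  Dstep (Dsub phi j s t) (Dsub phi j s t.+1) (tnth s t).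
Proof.
move=> sL; rewrite !(DsubE hA hq _ sL).
exact: (calL_step (G := Dtr) (step := @Dstep _ _ _ _ _ phi j)
  (fun B i => @Dstep_ex _ _ _ _ _ _ hA _ _ hq j B i)).
Qed.

Lemma size_scrD s : size (scrD phi j s) = r.+1.
Proof. by rewrite size_map size_iota. Qed.

Lemma nth_scrD x0 s k : (k <= r)%N -> nth x0 (scrD phi j s) k = Dsub phi j s (r - k).
Proof. by move=> kr; rewrite (nth_map 0%N) ?size_iota // nth_iota. Qed.

Lemma scrD_good s : calL j s -> good_filtrations (Delta phi) (P j) (scrD phi j s).
Proof.
move=> sL; split; rewrite ?size_scrD //.
- by rewrite nth_scrD // subn0 (DsubE hA hq _ sL) tailset_end; apply: trv_set0.
- rewrite -[r.+1.-1]/r nth_scrD // subnn (DsubE hA hq _ sL) tailset0 //.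
  exact: trv_Lambda.
(* The list runs upwards from 0, so its k-th subquotient carries the entry of s at index r - k -
   1. *)
move=> k; rewrite ltnS => kr; have tr : (r - k.+1 < r)%N by rewrite subnSK ?leq_subr.
rewrite !nth_scrD ?(ltnW kr) //; have [] := Dsub_step (Ordinal tr) sL.
by rewrite /= subnSK // => WU iU; split=> //; exists (tnth s (Ordinal tr)).
Qed.

Lemma scrD_bij : set_bij (calL j) (good_filtrations (Delta phi) (P j)) (scrD phi j).
Proof.
have ex := fun B i => @Dstep_ex _ _ _ _ _ _ hA _ _ hq j B i.
have lab := fun U W i i' => @Dstep_label _ _ _ _ _ _ hA _ _ hq j U W i i'.
have inv := fun B W l => @Dstep_inv _ _ _ _ _ _ hA _ _ hq j B W l.
have inj0 : forall B : {set V}, upset B -> B \subset Lambda j -> Dtr B = Dtr finset.set0 -> B = finset.set0.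
  by move=> B _; apply: (trv_inj0 hA hq).
split; first exact: scrD_good.
  move=> s s' /set_mem sL /set_mem sL' E.
  apply: (calL_chain_inj (G := Dtr) ex lab sL sL') => t tr.
  apply: etrans (esym (DsubE hA hq t sL)) (etrans _ (DsubE hA hq t sL')).
  have nD x := nth_scrD (sub0 (P j)) x (leq_subr t r); rewrite (subKn tr) in nD.
  exact: etrans (esym (nD s)) (etrans (f_equal (fun F => nth _ F (r - t)) E) (nD s')).
move=> F FD; have [F0 Fs Fe FF] := FD.
(* The filtration is read backwards, since [chain_calL] starts from Λ(j), whose trace is all of
   P(j). *)
pose m := (size F).-1; pose H t := nth (sub0 (P j)) F (m - t).
have Hs t : (t < m)%N -> exists i, Dstep (H t) (H t.+1) i.
  move=> tm; have [|WU [i iU]] := FF (m - t.+1)%N.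
    by rewrite -ltn_predRL -/m subnSK // leq_subr.
  by move: WU iU; rewrite subnSK // => WU iU; exists i.
have [||mr [s sL sE]] := chain_calL (G := Dtr) inv inj0 (H := H) (m := m) _ _ Hs.
- by rewrite /H subn0 Fe; apply/esym/trv_Lambda.
- by rewrite /H subnn Fs; apply/esym; apply: trv_set0.
exists s => //; have szF : size F = r.+1 by rewrite -mr /m prednK.
apply: (@eq_from_nth _ (sub0 (P j))); rewrite size_scrD ?szF // => k; rewrite ltnS => kr.
rewrite nth_scrD // (DsubE hA hq _ sL) -[LHS]/(Dtr _) -sE ?leq_subr // /H.
by rewrite mr subKn.
Qed.

Variable p : modhom (P one) (I j).
Hypothesis sp : surjection p.

Lemma Nsub_step s (t : 'I_r) : calL j s -> Nstep (Nsub p s t) (Nsub p s t.+1) (tnth s t).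
Proof.
move=> sL; rewrite !(NsubE hA hq _ sp sL).
exact: (calL_step (G := Nrej) (step := @Nstep _ _ _ _ _ phi j)
  (fun B i => @Nstep_ex _ _ _ _ _ _ hA _ _ hq j B i)).
Qed.

Lemma size_scrN s : size (scrN p s) = r.+1.
Proof. by rewrite size_map size_iota. Qed.

Lemma nth_scrN x0 s k : (k <= r)%N -> nth x0 (scrN p s) k = Nsub p s k.
Proof. by move=> kr; rewrite (nth_map 0%N) ?size_iota // nth_iota. Qed.

Lemma scrN_good s : calL j s -> good_filtrations (Nabla phi) (I j) (scrN p s).
Proof.
move=> sL; split; rewrite ?size_scrN //.
- by rewrite nth_scrN // (NsubE hA hq _ sp sL) tailset0 //; apply: rejv_Lambda.
- by rewrite -[r.+1.-1]/r nth_scrN // (NsubE hA hq _ sp sL) tailset_end; apply: rejv_set0.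
move=> k; rewrite ltnS => kr; rewrite !nth_scrN ?(ltnW kr) //.
by have [] := Nsub_step (Ordinal kr) sL; split=> //; exists (tnth s (Ordinal kr)).
Qed.

Lemma scrN_bij : set_bij (calL j) (good_filtrations (Nabla phi) (I j)) (scrN p).
Proof.
have ex := fun B i => @Nstep_ex _ _ _ _ _ _ hA _ _ hq j B i.
have lab := fun U W i i' => @Nstep_label _ _ _ _ _ _ hA _ _ hq j U W i i'.
have inv := fun B W l => @Nstep_inv _ _ _ _ _ _ hA _ _ hq j B W l.
have inj0 : forall B : {set V}, upset B -> B \subset Lambda j -> Nrej B = Nrej finset.set0 -> B = finset.set0.
  by move=> B; apply: (rejv_inj0 hA hq).
split; first exact: scrN_good.
  move=> s s' /set_mem sL /set_mem sL' E.
  apply: (calL_chain_inj (G := Nrej) (step := @Nstep _ _ _ _ _ phi j) ex lab sL sL') => t tr.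
  apply: etrans (esym (NsubE hA hq t sp sL)) (etrans _ (NsubE hA hq t sp sL')).
  have nN x := nth_scrN (sub0 (I j)) x tr.
  exact: etrans (esym (nN s)) (etrans (f_equal (fun F => nth _ F t) E) (nN s')).
move=> F FN; have [F0 Fs Fe FF] := FN.
(* No reversal here: the reject of Λ(j) is 0 and that of the empty set is I(j). *)
pose m := (size F).-1; pose H := nth (sub0 (I j)) F.
have Hs t : (t < m)%N -> exists i, Nstep (H t) (H t.+1) i.
  by rewrite /m ltn_predRL => /FF[WU [i iU]]; exists i.
have [||mr [s sL sE]] := chain_calL (G := Nrej) (step := @Nstep _ _ _ _ _ phi j) inv inj0 (H := H) (m := m) _ _ Hs.
- by rewrite /H Fs; apply/esym; apply: rejv_Lambda.
- by rewrite /H Fe; apply/esym; apply: rejv_set0.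
exists s => //; have szF : size F = r.+1 by rewrite -mr /m prednK.
apply: (@eq_from_nth _ (sub0 (I j))); rewrite size_scrN ?szF // => k; rewrite ltnS => kr.
by rewrite nth_scrN // (NsubE hA hq _ sp sL) -[LHS]/(Nrej _) -sE.
Qed.

End GoodFiltrations.

Unset Implicit Arguments.

Theorem proposition4p2 (K : closedFieldType) (d : Order.disp_t)
  (V : finPOrderType d) (Q : quiver V) (A : falgType K)
  (phi : {rmorphism path_algebra Q K -> A}) (one top : V)
  (hA : bound_quiver_algebra phi) (hqh : one_quasi_hereditary phi one top)
  (j : V) :
  [/\ forall i, i \in Lambda j ->
        unique (fun U : submodule (Pmod phi j) => iso (submod U) (Pmod phi i))
          (Psub phi j i),
      set_bij (calL j) (good_filtrations (Delta phi) (Pmod phi j))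
        (scrD phi j) &
      forall s, calL j s -> forall t : 'I_#|Lambda j|,
        (Dsub phi j s t.+1 <= Dsub phi j s t)%VS /\
        iso (subquot (Dsub phi j s t) (Dsub phi j s t.+1)) (Delta phi (tnth s t))]
  /\
  [/\ forall i, (exists f : modhom (Pmod phi one) (Imod phi i), surjection f) /\
        forall f : modhom (Pmod phi one) (Imod phi i), surjection f ->
          hker f = calK phi one i &
      forall p : modhom (Pmod phi one) (Imod phi j), surjection p ->
        set_bij (calL j) (good_filtrations (Nabla phi) (Imod phi j))
          (scrN p) /\
        forall s, calL j s -> forall t : 'I_#|Lambda j|,
          (Nsub p s t <= Nsub p s t.+1)%VS /\
          iso (subquot (Nsub p s t.+1) (Nsub p s t)) (Nabla phi (tnth s t))].
Proof.
split; split.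
- move=> i; rewrite inE => ji; rewrite (PsubE hA hqh ji); split.
    exact: (iso_tr_Pmod hA hqh ji).
  by move=> U iU; apply/esym; apply: (tr_unique hA hqh ji iU).
- exact: (scrD_bij hA hqh).
- by move=> s sL t; apply: (Dsub_step hA hqh).
- move=> i; split; first exact: (Imod_surj hA hqh).
  by move=> f sf; rewrite (hker_Imod hA hqh sf) (calKE hA hqh).
- move=> p sp; split; first exact: (scrN_bij hA hqh sp).
  by move=> s sL t; apply: (Nsub_step hA hqh sp).
Qed.
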